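(* Let $p \geq 2$ be a prime number and let $\mathcal{K}_p^s$ be the family of cyclic number fields $K$ of degree $p$ over $\mathbb{Q}$, where for $p=2$ one fixes a signature $s \in \{+1,-1\}$ (i.e. one considers only real quadratic fields, or only imaginary quadratic fields), and for $p>2$ all such fields are (necessarily) real. For $K \in \mathcal{K}_p^s$ let $f = f_K$ be its conductor, $D = |D_K| = f^{p-1}$ the absolute value of its discriminant, $N = \omega(f)$ the number of distinct prime divisors of $f$ (i.e. the number of primes ramified in $K$), and $H = \#\mathcal{C}\ell_K$ its class number. Assume the following hypothesis: for every $\eta \in \,]0,1[$ there exist infinitely many $K \in \mathcal{K}_p^s$ such that $\#\mathcal{C}\ell_K \geq (\sqrt{|D_K|}\,)^{1-\eta}$. Let $\varepsilon \in \,]0,1[$. Order the fields of $\mathcal{K}_p^s$ by increasing conductors $f$ (equivalently increasing $D = f^{p-1}$) and consider $$C_\varepsilon(K) = \frac{H}{p^{N-1}\cdot (\sqrt{D}\,)^{\varepsilon}}, \qquad K \in \mathcal{K}_p^s.$$ Then the sequence of successive maxima of $C_\varepsilon(K)$ is infinite.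
   Context: For a sequence $(X_i)_{i\geq 1}$ of positive real numbers, its sequence of successive maxima $(Y_n)_{n\ge1}$ is defined inductively by $Y_1 = X_1$ and $Y_{n+1} = X_{i_{n+1}}$ where $i_{n+1}$ is the smallest index with $X_{i_{n+1}} > Y_n$ (if no such index exists the sequence stops); thus $Y_{n+1} > Y_n$ and the sequence of successive maxima may be finite or infinite. Here $X_i = C_\varepsilon(K_i)$ where $K_1, K_2, \dots$ enumerates $\mathcal{K}_p^s$ by increasing conductor. For real quadratic fields the class group $\mathcal{C}\ell_K$ is taken in the restricted (narrow) sense, so that $p^{N-1} = 2^{N-1}$ is the genus number; the quantity $H/p^{N-1}$ is the order of $\mathcal{C}\ell_K/\mathcal{C}\ell_K^{G} \simeq \mathcal{C}\ell_K^{1-\sigma}$, where $G = \mathrm{Gal}(K/\mathbb{Q}) = \langle \sigma\rangle$. *)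

(* Defs.v *)
From HB Require Import structures.
From mathcomp Require Import all_boot all_order all_algebra all_fingroup.
From mathcomp Require Import all_solvable all_field.
From mathcomp Require Import finmap.
From mathcomp Require Import boolp classical_sets cardinality reals exp.

Set Implicit Arguments.
Unset Strict Implicit.
Unset Printing Implicit Defensive.

Import Order.TTheory GRing.Theory Num.Theory.
Local Open Scope classical_set_scope.
Local Open Scope ring_scope.

(* Number fields are taken up to isomorphism: two Galois number fields are
   isomorphic if and only if they are equal as subfields of algC. *)
Definition field_iso (K L : splittingFieldType rat) : Prop :=
  exists f : {rmorphism K -> L}, bijective f.

Definition infinitely_many_fields (P : splittingFieldType rat -> Prop) : Prop :=
  exists L : nat -> splittingFieldType rat,
    (forall i, P (L i)) /\ (forall i j, field_iso (L i) (L j) -> i = j).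

Definition totally_real (K : splittingFieldType rat) : Prop :=
  forall (f : {rmorphism K -> algC}) (x : K), f x \is Num.real.

Definition totally_positive (K : splittingFieldType rat) (x : K) : Prop :=
  forall f : {rmorphism K -> algC},
    (forall y : K, f y \is Num.real) -> 0 < f x.

Variant signature := RealSignature | ImaginarySignature.

(* The signature is a constraint for p = 2 only. *)
Definition cyclic_field (p : nat) (s : signature)
    (K : splittingFieldType rat) : Prop :=
  [/\ galois 1 {:K}, cyclic 'Gal({:K} / 1), \dim {:K} = p &
      p = 2%N -> (totally_real K <-> s = RealSignature)].

Definition embeds_in_cyclotomic (K : splittingFieldType rat) (m : nat) : Prop :=
  exists (f : {rmorphism K -> algC}) (z : algC), m.-primitive_root z /\
    forall x : K, exists q : {poly rat}, f x = (map_poly ratr q).[z].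

Definition is_conductor (K : splittingFieldType rat) (m : nat) : Prop :=
  [/\ (0 < m)%N, embeds_in_cyclotomic K m &
      forall m', (0 < m')%N -> embeds_in_cyclotomic K m' -> (m <= m')%N].

(* Every abelian K has a conductor by the Kronecker-Weber theorem; the default
   value 0 is then never taken. *)
Definition conductor (K : splittingFieldType rat) : nat :=
  xget 0%N [set m | is_conductor K m].

Definition omega (m : nat) : nat := size (primes m).

Definition integers (K : splittingFieldType rat) : set K :=
  [set x | integralOver (intr : int -> K) x].

Definition integral_basis (K : splittingFieldType rat)
    (b : (\dim {:K}).-tuple K) : Prop :=
  [/\ basis_of {:K} b, (forall i, integers (tnth b i)) &
      forall x : K, integers x ->
        exists c : 'I_(\dim {:K}) -> int, x = \sum_i tnth b i *~ c i].

(* For K Galois over Q, galTrace 1 {:K} is the trace of K over Q. *)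
Definition is_discriminant (K : splittingFieldType rat) (d : int) : Prop :=
  exists b : (\dim {:K}).-tuple K, integral_basis b /\
    \det (\matrix_(i, j) galTrace 1 {:K} (tnth b i * tnth b j)) = d%:~R.

(* An integral basis exists and the determinant does not depend on it, so the
   default value 0 is never taken. *)
Definition discriminant (K : splittingFieldType rat) : int :=
  xget 0 [set d | is_discriminant K d].

Definition fractional_ideal (K : splittingFieldType rat) (I : set K) : Prop :=
  [/\ (forall x y, I x -> I y -> I (x + y)),
      (forall a x, integers a -> I x -> I (a * x)),
      (exists2 x, I x & x != 0) &
      exists2 d : K, d != 0 & forall x, I x -> integers (d * x)].

(* The quotient of the group of fractional ideals by the principal ideals with
   a generator in P, as a set of cosets: the coset of I consists of the a I. *)
Definition ideal_classes (K : splittingFieldType rat) (P : set K) :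
    set (set (set K)) :=
  [set C | exists2 I : set K, fractional_ideal I &
    C = [set J | exists a : K, [/\ a != 0, P a & J = [set a * x | x in I]]]].

Definition class_group (K : splittingFieldType rat) : set (set (set K)) :=
  ideal_classes (@setT K).

Definition narrow_class_group (K : splittingFieldType rat) :
    set (set (set K)) :=
  ideal_classes [set a : K | totally_positive a].

Arguments class_group : clear implicits.
Arguments narrow_class_group : clear implicits.

(* The narrow sense is used for real quadratic fields only. Class groups are
   finite, so fset_set does not return its default value fset0. *)
Definition class_number (K : splittingFieldType rat) : nat :=
  if (\dim {:K} == 2%N) && `[< totally_real K >]
  then #|` fset_set (narrow_class_group K)|
  else #|` fset_set (class_group K)|.

Definition sqrt_disc (R : realType) (K : splittingFieldType rat) : R :=
  Num.sqrt (`|discriminant K|%N)%:R.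

Definition C_eps (R : realType) (p : nat) (eps : R)
    (K : splittingFieldType rat) : R :=
  (class_number K)%:R /
    (p%:R ^+ (omega (conductor K) - 1) * sqrt_disc R K `^ eps).

(* For p > 2 several fields may share a conductor: the enumeration is
   nondecreasing and ties may be ordered arbitrarily. *)
Definition enumeration_by_conductor (p : nat) (s : signature)
    (K : nat -> splittingFieldType rat) : Prop :=
  [/\ (forall i, cyclic_field p s (K i)),
      (forall i j, field_iso (K i) (K j) -> i = j),
      (forall L, cyclic_field p s L -> exists i, field_iso L (K i)) &
      forall i j, (i <= j)%N -> (conductor (K i) <= conductor (K j))%N].

(* successive_max X n y means that Y_n exists and Y_n = y, where X_1, X_2 and
   so on are X 0, X 1 and so on. *)
Inductive successive_max (R : realType) (X : nat -> R) : nat -> R -> Prop :=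
| successive_max1 : successive_max X 1 (X 0%N)
| successive_maxS n y i : successive_max X n y ->
    y < X i -> (forall j, y < X j -> (i <= j)%N) ->
    successive_max X n.+1 (X i).

Definition infinite_successive_maxima (R : realType) (X : nat -> R) : Prop :=
  forall n, (0 < n)%N -> exists y, successive_max X n y.

(* Main.v *)
Require Import Defs.
From HB Require Import structures.
From mathcomp Require Import all_boot all_order all_algebra all_fingroup.
From mathcomp Require Import all_solvable all_field.
From mathcomp Require Import ring lra zify.
From mathcomp Require Import finmap.
From mathcomp Require Import boolp classical_sets cardinality reals exp.

(** If H >= sqrt(D)^(1 - eta) with eta < 1 - eps, then C_eps(K) is at least
    sqrt(D)^(1 - eta - eps) / p^(N - 1), so the sequence has no maximum as soon
    as p^(N - 1) is O(D^delta) for every delta > 0 and D is unbounded on every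
    infinite family of fields.

    For the first point, every prime q <> p dividing the conductor m divides D,
    hence p^(N - 1) <= p^omega(D).  If q^2 divides m, the Galois group of
    Q(zeta_m) over Q(zeta_(m/q)) has order q, so it acts trivially on K, against
    the minimality of m.  If q divides m exactly once, some automorphism of
    Q(zeta_m) over Q(zeta_(m/q)) acts on K as some sigma <> 1; it is trivial on
    algebraic integers modulo the radical of q, so that the columns 1 and sigma
    of the matrix of conjugates of an integral basis are congruent and q
    divides D.

    For the second point (Hermite), complex conjugation c commutes with the
    Galois group, and Tr(x c(y)) is a positive definite integral form of
    determinant D on the integers of K.  Reduction theory bounds two independent
    vectors of this form, one of which is irrational and thus generates K; it is
    a root of one of finitely many polynomials when D is bounded. *)

Set Implicit Arguments.
Unset Strict Implicit.
Unset Printing Implicit Defensive.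

Import Order.TTheory GRing.Theory Num.Theory.
Local Open Scope ring_scope.

(** * Traces between cyclotomic fields *)

(** Membership in Q(z): for algebraic [z] the polynomial values already form a field. The shape is
    that of [embeds_in_cyclotomic]. *)
Definition in_cyclotomic (z x : algC) : Prop :=
  exists q : {poly rat}, x = (map_poly ratr q).[z].

Lemma in_cyclotomicD z x y :
  in_cyclotomic z x -> in_cyclotomic z y -> in_cyclotomic z (x + y).
Proof. by move=> [p ->] [q ->]; exists (p + q); rewrite rmorphD hornerD. Qed.

Lemma in_cyclotomicN z x : in_cyclotomic z x -> in_cyclotomic z (- x).
Proof. by move=> [p ->]; exists (- p); rewrite rmorphN hornerN. Qed.

Lemma in_cyclotomicM z x y :
  in_cyclotomic z x -> in_cyclotomic z y -> in_cyclotomic z (x * y).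
Proof. by move=> [p ->] [q ->]; exists (p * q); rewrite rmorphM hornerM. Qed.

Lemma in_cyclotomic_ratr z (a : rat) : in_cyclotomic z (ratr a).
Proof. by exists a%:P; rewrite map_polyC hornerC. Qed.

Lemma in_cyclotomic_exp z i : in_cyclotomic z (z ^+ i).
Proof. by exists 'X^i; rewrite map_polyXn hornerXn. Qed.

Lemma in_cyclotomic_expM z m i : (m %| i)%N -> in_cyclotomic (z ^+ m) (z ^+ i).
Proof.
by case/dvdnP=> j ->; rewrite mulnC exprM; apply: in_cyclotomic_exp.
Qed.

Lemma in_cyclotomic_sum z (I : Type) (r : seq I) (P : pred I) (F : I -> algC) :
  (forall i, P i -> in_cyclotomic z (F i)) ->
  in_cyclotomic z (\sum_(i <- r | P i) F i).
Proof.
move=> F_z; elim/big_rec: _ => [|i x Pi].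
  by rewrite -(rmorph0 (ratr : rat -> algC)); apply: in_cyclotomic_ratr.
by apply: in_cyclotomicD; apply: F_z.
Qed.

Lemma in_cyclotomicZK z n x :
  (0 < n)%N -> in_cyclotomic z (x *+ n) -> in_cyclotomic z x.
Proof.
move=> n_gt0 xn_z.
have -> : x = ratr n%:R^-1 * (x *+ n).
  by rewrite fmorphV rmorph_nat -[x *+ n]mulr_natl mulKf // pnatr_eq0 -lt0n.
by apply: in_cyclotomicM => //; apply: in_cyclotomic_ratr.
Qed.

Lemma rmorph_horner_ratr (u : {rmorphism algC -> algC}) (P : {poly rat}) z :
  u (map_poly ratr P).[z] = (map_poly ratr P).[u z].
Proof.
rewrite -horner_map -map_poly_comp; congr (_.[_]).
by apply: eq_map_poly => a /=; rewrite fmorph_rat.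
Qed.

Lemma in_cyclotomic_eq_aut (u v : {rmorphism algC -> algC}) z x :
  in_cyclotomic z x -> u z = v z -> u x = v x.
Proof. by move=> [P ->] uv; rewrite !rmorph_horner_ratr uv. Qed.

(** Automorphisms are taken on all of [algC] so that they compose freely. Outside the [n]-th
    cyclotomic field the extension is arbitrary, and [idfun] is the default when [k] is not coprime
    to [n]. *)
Definition aut_pow (n k : nat) : {rmorphism algC -> algC} :=
  if @idP (coprime k n) is ReflectT c then sval (Qn_aut_exists c) else idfun.

Lemma aut_powE n k z : coprime k n -> z ^+ n = 1 -> aut_pow n k z = z ^+ k.
Proof.
move=> kn zn; rewrite /aut_pow; case: {-}_ / idP => // c.
by case: (Qn_aut_exists c) => u /= ->.
Qed.

Lemma exp_prim_root_mul q m (z : algC) :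
  (q * m).-primitive_root z -> m.-primitive_root (z ^+ q).
Proof.
move=> z_prim; have := prim_order_gt0 z_prim; rewrite muln_gt0 => /andP[q_gt0 _].
by have := exp_prim_root z_prim q; rewrite gcdnMr mulKn.
Qed.

(* The exponents of the conjugates of a [(q * m)]-th root of unity over
   the field of [m]-th roots of unity. *)
Definition rel_exp (q m : nat) : pred nat :=
  fun k => (k == 1 %[mod m])%N && coprime k (q * m).

(** Inclusion-exclusion: from all exponents congruent to 1 modulo [m], remove those divisible by
    [q]. The removed terms are powers of [z ^+ q]. So are all terms when [q] divides [i]; otherwise
    the full sum vanishes, being invariant under multiplication by a root of unity other than 1. *)
Lemma sum_rel_exp q m z i :
  prime q -> (0 < m)%N -> (q * m).-primitive_root z ->
  in_cyclotomic (z ^+ q) (\sum_(k < q * m | rel_exp q m k) z ^+ (i * k)).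
Proof.
move=> q_pr m_gt0 z_prim; have q_gt0 := prime_gt0 q_pr.
have split_sum: \sum_(k < q * m | (k == 1 %[mod m])%N) z ^+ (i * k) =
    \sum_(k < q * m | rel_exp q m k) z ^+ (i * k) +
    \sum_(k < q * m | (k == 1 %[mod m])%N && (q %| k)%N) z ^+ (i * k).
  rewrite (bigID (fun k : 'I_(q * m) => ~~ (q %| k)%N)) /=; congr (_ + _).
    apply: eq_bigl => k; rewrite /rel_exp; case: eqP => //= k1.
    rewrite coprimeMr [coprime k q]coprime_sym prime_coprime //.
    by rewrite -(coprime_modl k) k1 coprime_modl coprime1n andbT.
  by apply: eq_bigl => k; rewrite negbK.
have {split_sum} ->: \sum_(k < q * m | rel_exp q m k) z ^+ (i * k) =
    \sum_(k < q * m | (k == 1 %[mod m])%N) z ^+ (i * k) -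
    \sum_(k < q * m | (k == 1 %[mod m])%N && (q %| k)%N) z ^+ (i * k).
  by rewrite split_sum addrK.
apply: in_cyclotomicD; last first.
  apply/in_cyclotomicN/in_cyclotomic_sum => k /andP[_ qk].
  by apply: in_cyclotomic_expM; rewrite dvdn_mull.
have [qi|qi] := boolP (q %| i)%N.
  by apply: in_cyclotomic_sum => k _; apply: in_cyclotomic_expM; rewrite dvdn_mulr.
suff -> : \sum_(k < q * m | (k == 1 %[mod m])%N) z ^+ (i * k) = 0.
  by rewrite -(rmorph0 (ratr : rat -> algC)); apply: in_cyclotomic_ratr.
set s := \sum_(k < _ | _) _.
have qm_gt0 : (0 < q * m)%N by rewrite muln_gt0 q_gt0.
pose sh (k : 'I_(q * m)) : 'I_(q * m) := Ordinal (ltn_pmod (k + m) qm_gt0).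
have sh_inj : injective sh.
  move=> k l /(congr1 val) /= /eqP; rewrite eqn_modDr !modn_small ?ltn_ord //.
  by move/eqP/val_inj.
(* Multiplying by [z ^ (i m)] permutes the terms. *)
have : z ^+ (i * m) * s = s.
  rewrite {2}/s (reindex_inj sh_inj) /= mulr_sumr; apply: eq_big => k.
    by rewrite modn_dvdm ?dvdn_mull // modnDr.
  move=> _; rewrite -exprD -(prim_expr_mod z_prim (i * _)) modnMmr.
  by rewrite prim_expr_mod // mulnDr addnC.
move/eqP; rewrite -{2}[s]mul1r -subr_eq0 -mulrBl mulf_eq0 subr_eq0.
rewrite -(prim_order_dvd z_prim) dvdn_pmul2r // (negPf qi) orFb.
by move/eqP.
Qed.

(** On Q(z), with [z] a primitive root of order [q * m], this is the trace down to Q(z^q). *)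
Definition rel_trace (q m : nat) (x : algC) : algC :=
  \sum_(k < q * m | rel_exp q m k) aut_pow (q * m) k x.

Lemma rel_trace_in q m z x :
  prime q -> (0 < m)%N -> (q * m).-primitive_root z ->
  in_cyclotomic z x -> in_cyclotomic (z ^+ q) (rel_trace q m x).
Proof.
move=> q_pr m_gt0 z_prim [P ->].
have -> : rel_trace q m (map_poly ratr P).[z] =
    \sum_(i < size P) ratr P`_i *
       \sum_(k < q * m | rel_exp q m k) z ^+ (i * k).
  under [RHS]eq_bigr do rewrite mulr_sumr.
  rewrite exchange_big /=; apply: eq_bigr => k /andP[_ k_co].
  rewrite rmorph_horner_ratr aut_powE ?(prim_expr_order z_prim) //.
  rewrite horner_coef size_map_poly; apply: eq_bigr => i _.
  by rewrite coef_map /= -exprM mulnC.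
apply: in_cyclotomic_sum => i _; apply: in_cyclotomicM.
  exact: in_cyclotomic_ratr.
exact: sum_rel_exp.
Qed.

Lemma rel_exp1 q m : prime q -> (0 < m)%N -> rel_exp q m (1 %% (q * m))%N.
Proof.
move=> q_pr m_gt0; rewrite /rel_exp modn_dvdm ?dvdn_mull // eqxx /=.
by rewrite coprime_modl coprime1n.
Qed.

(** One step of the Galois correspondence: the relative trace of a fixed [x] is a positive multiple
    of [x], and it lies in the smaller field. *)
Lemma in_cyclotomic_descent q m z x :
  prime q -> (0 < m)%N -> (q * m).-primitive_root z -> in_cyclotomic z x ->
  (forall u : {rmorphism algC -> algC}, u (z ^+ q) = z ^+ q -> u x = x) ->
  in_cyclotomic (z ^+ q) x.
Proof.
move=> q_pr m_gt0 z_prim x_z x_fix; have q_gt0 := prime_gt0 q_pr.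
have qm_gt0 : (0 < q * m)%N by rewrite muln_gt0 q_gt0.
have := rel_trace_in q_pr m_gt0 z_prim x_z; rewrite /rel_trace.
under eq_bigr => k /andP[/eqP k1 k_co].
  rewrite x_fix; last first.
    rewrite aut_powE // -?exprM.
      apply/eqP; rewrite (eq_prim_root_expr z_prim) -muln_modr.
      by rewrite k1 muln_modr muln1.
    by rewrite mulnC exprM (prim_expr_order z_prim) expr1n.
  over.
rewrite sumr_const; apply: in_cyclotomicZK.
by apply/card_gt0P; exists (Ordinal (ltn_pmod 1 qm_gt0)); apply: rel_exp1.
Qed.

(** Descent removes the prime factors of [n] one at a time, down to Q(1). *)
Lemma Crat_fixed n z x :
  n.-primitive_root z -> in_cyclotomic z x ->
  (forall u : {rmorphism algC -> algC}, u x = x) -> x \in Crat.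
Proof.
move=> z_prim x_z x_fix.
have [k] := ubnP n; elim: k => // k IHk in n z z_prim x_z *; rewrite ltnS => n_le.
have n_gt0 := prim_order_gt0 z_prim.
have [n_le1|n_gt1] := leqP n 1.
  have n1 : n = 1%N by apply/eqP; rewrite eqn_leq n_le1.
  have := prim_expr_order z_prim; rewrite n1 expr1 => z1.
  have [P ->] := x_z; rewrite z1.
  rewrite -(rmorph1 (ratr : rat -> algC)) horner_map /=.
  by apply/CratP; exists P.[1].
have [q q_pr /dvdnP[m Dn]] : exists2 q, prime q & (q %| n)%N.
  by exists (pdiv n); rewrite ?pdiv_prime ?pdiv_dvd.
have m_gt0 : (0 < m)%N by move: n_gt0; rewrite Dn muln_gt0 => /andP[].
have Dn' : n = (q * m)%N by rewrite mulnC.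
apply: (IHk m (z ^+ q)).
- by move: z_prim; rewrite Dn'; apply: exp_prim_root_mul.
- move: z_prim; rewrite Dn' => z_prim.
  by apply: (in_cyclotomic_descent q_pr m_gt0 z_prim).
by apply: leq_trans n_le; rewrite Dn' ltn_Pmull // prime_gt1.
Qed.

Lemma in_cyclotomic_aut n z x (u : {rmorphism algC -> algC}) :
  n.-primitive_root z -> in_cyclotomic z x -> in_cyclotomic z (u x).
Proof.
move=> z_prim [P ->]; rewrite rmorph_horner_ratr.
have [k _ ->] := aut_prim_rootP u z_prim.
exists (P \Po 'X^k); rewrite -[map_poly _ (P \Po _)]/(map_poly ratr _).
by rewrite map_comp_poly map_polyXn horner_comp hornerXn.
Qed.

Lemma aut_pow1 n z x :
  n.-primitive_root z -> in_cyclotomic z x -> aut_pow n (1 %% n) x = x.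
Proof.
move=> z_prim x_z; apply: (in_cyclotomic_eq_aut (v := idfun) x_z) => /=.
rewrite aut_powE ?(prim_expr_order z_prim) ?coprime_modl ?coprime1n //.
by rewrite (prim_expr_mod z_prim) expr1.
Qed.

Lemma geometric_root_sum (F : fieldType) n (w : F) :
  w ^+ n = 1 -> w != 1 -> \sum_(j < n) w ^+ j = 0.
Proof.
move=> wn w1; have := subrX1 w n; rewrite wn subrr => /esym/eqP.
by rewrite mulf_eq0 subr_eq0 (negPf w1) => /eqP.
Qed.

Lemma unity_expV_Aint n (z : algC) j : z ^+ n = 1 -> (0 < n)%N -> z ^- j \in Aint.
Proof.
move=> zn n_gt0; apply: (Aint_unity_root n_gt0).
by apply/unity_rootP; rewrite exprVn -exprM mulnC exprM zn expr1n invr1.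
Qed.

(** Fourier inversion, [t j] being the trace of [x * z ^- j] to the rationals: the conjugate of
    exponent [k] contributes a geometric sum of ratio z^(1-k), which vanishes unless [k] is 1 modulo
    [n]. This stands in for the equality of the ring of integers with Z[z], at the price of a factor
    [n]. *)
Lemma trace_expansion n z x :
  n.-primitive_root z -> in_cyclotomic z x -> x \in Aint ->
  exists2 t : nat -> algC, (forall j, t j \in Num.int) &
    x *+ n = \sum_(j < n) t j * z ^+ j.
Proof.
move=> z_prim x_z xA; have n_gt0 := prim_order_gt0 z_prim.
have zn := prim_expr_order z_prim; have z_n0 : z != 0.
  by rewrite (prim_root_eq0 z_prim) -lt0n.
have zV_z j : in_cyclotomic z (z ^- j).
  have [k] : {k : 'I_n | z ^- j = z ^+ k}.
    by apply: (prim_rootP z_prim); rewrite exprVn -exprM mulnC exprM zn expr1n invr1.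
  by move=> ->; apply: in_cyclotomic_exp.
exists (fun j => \sum_(k < n | coprime k n) aut_pow n k (x * z ^- j)) => [j|].
  have xj_z : in_cyclotomic z (x * z ^- j) by apply: in_cyclotomicM.
  apply: Cint_rat_Aint; last first.
    apply: rpred_sum => k _; rewrite Aint_aut rpredM //.
    exact: unity_expV_Aint zn n_gt0.
  apply: (Crat_fixed z_prim).
    by apply: in_cyclotomic_sum => k _; apply: (in_cyclotomic_aut _ z_prim).
  (* As [u] raises [z] to some power [c], it permutes the conjugates, sending exponent [k] to
     [c * k]; hence it fixes the trace. *)
  move=> u; have [c c_co uz] := aut_prim_rootP u z_prim.
  pose h (k : 'I_n) : 'I_n := Ordinal (ltn_pmod (c * k) n_gt0).
  have h_inj : injective h.
    move=> k l /(congr1 val)/= /eqP.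
    rewrite -(eq_prim_root_expr z_prim) !exprM -uz -!rmorphXn /=.
    move=> /eqP/fmorph_inj/eqP; rewrite (eq_prim_root_expr z_prim).
    by rewrite !modn_small ?ltn_ord // => /eqP/val_inj.
  rewrite rmorph_sum [RHS](reindex_inj h_inj) /=; apply: eq_big => k.
    by rewrite coprime_modl coprimeMl c_co.
  move=> k_co; apply: (in_cyclotomic_eq_aut (u := u \o aut_pow n k) xj_z) => /=.
  rewrite !aut_powE // ?coprime_modl ?coprimeMl ?c_co // rmorphXn /= uz.
  by rewrite (prim_expr_mod z_prim) exprM.
under eq_bigr do rewrite mulr_suml.
rewrite exchange_big /= (bigD1 (Ordinal (ltn_pmod 1 n_gt0))) /=; last first.
  by rewrite coprime_modl coprime1n.
rewrite [X in _ + X]big1 ?addr0 => [|k /andP[k_co k_n1]].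
  rewrite (eq_bigr (fun=> x)) ?sumr_const ?card_ord // => j _.
  by rewrite (aut_pow1 z_prim) ?divfK ?expf_neq0 //; apply: in_cyclotomicM.
under eq_bigr => j _ do
  rewrite rmorphM fmorphV rmorphXn /= -mulrA (aut_powE k_co zn) -exprVn -exprMn.
rewrite -mulr_sumr geometric_root_sum ?mulr0 //.
  by rewrite exprMn exprVn -exprM mulnC exprM zn expr1n invr1 mulr1.
apply: contraNneq k_n1 => zk1.
have /eqP : z ^+ k = z ^+ 1.
  by rewrite -[LHS]mulr1 -zk1 mulVKf ?expf_neq0.
by rewrite (eq_prim_root_expr z_prim) modn_small.
Qed.

(** * Inertia at a tamely ramified prime *)

Lemma eqAmodX e k :
  {in Aint &, forall x y, x == y %[mod e] -> x ^+ k == y ^+ k %[mod e]}%A.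
Proof.
move=> x y xA yA xy; elim: k => [|k IHk]; first by rewrite !expr0.
by rewrite !exprS eqAmodM ?rpredX.
Qed.

Lemma eqAmod_sum e (I : Type) (r : seq I) (P : pred I) (F G : I -> algC) :
  (forall i, P i -> F i == G i %[mod e])%A ->
  (\sum_(i <- r | P i) F i == \sum_(i <- r | P i) G i %[mod e])%A.
Proof.
move=> FG; elim/big_rec2: _ => // i x y Pi xy.
by apply: eqAmodD => //; apply: FG.
Qed.

Lemma dvdA_mulr (e x y : algC) : (e %| x)%A -> y \in Aint -> (e %| x * y)%A.
Proof.
by rewrite -!eqAmod0 => ex yA; have := eqAmodMr yA ex; rewrite mul0r.
Qed.

Lemma dvdA_nat_mulr (q : nat) x : x \in Aint -> (q %| q%:R * x)%A.
Proof. by move=> xA; rewrite -eqAmod0 eqAmodMr0. Qed.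

Lemma eqAmod_exprD (q : nat) : prime q ->
  {in Aint &, forall x y, (x + y) ^+ q == x ^+ q + y ^+ q %[mod q]}%A.
Proof.
move=> q_pr x y xA yA; have q_gt0 := prime_gt0 q_pr.
rewrite exprDn -(prednK q_gt0) big_ord_recr big_ord_recl /= (prednK q_gt0).
rewrite /bump /= !subn0 subnn binn bin0 !mulr1n mulr1 mul1r.
rewrite eqAmodDr -{2}[x ^+ q]addr0 eqAmodDl eqAmod0 rpred_sum // => i _.
have /dvdnP[c ->] : (q %| 'C(q, i.+1))%N.
  by rewrite prime_dvd_bin //= -{2}(prednK q_gt0) ltnS ltn_ord.
rewrite mulrnA -mulr_natl dvdA_nat_mulr // rpredMn // rpredM ?rpredX //.
Qed.

Lemma eqAmod_expr_sum (q : nat) (I : Type) (r : seq I) (F : I -> algC) :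
  prime q -> (forall i, F i \in Aint) ->
  ((\sum_(i <- r) F i) ^+ q == \sum_(i <- r) F i ^+ q %[mod q])%A.
Proof.
move=> q_pr FA; elim: r => [|i r IHr].
  by rewrite !big_nil expr0n gtn_eqF ?prime_gt0.
rewrite !big_cons; apply: eqAmod_trans (eqAmod_exprD q_pr _ _) _ => //.
  by rewrite rpred_sum.
by rewrite eqAmodDl.
Qed.

Lemma eqAmod_fermat (q : nat) t :
  prime q -> t \in Num.int -> (t ^+ q == t %[mod q])%A.
Proof.
(* For a natural number, additivity of the Frobenius is applied to a sum of [n] ones. *)
move=> q_pr; have fermat_nat n : (n%:R ^+ q == n%:R %[mod q])%A.
  have := @eqAmod_expr_sum q _ (index_enum 'I_n) (fun=> 1) q_pr (fun=> Aint1).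
  by rewrite expr1n sumr_const card_ord.
case/intrP=> z ->; have q_n0 : q%:Z != 0 by rewrite -lt0n prime_gt0.
have zr : (z%:~R == `|(z %% q)%Z|%N%:R %[mod q])%A.
  rewrite [z in z%:~R](divz_eq z q) rmorphD rmorphM /= -[X in _ + X]/(_%:~R).
  rewrite pmulrn gez0_abs ?modz_ge0 // -[q%:~R]/(q%:R).
  by rewrite eqAmod_addl_mul // Aint_int.
apply: (eqAmod_trans (eqAmodX _ _ _ zr)); rewrite ?rpred_nat ?Aint_int //.
by apply: eqAmod_trans (fermat_nat _) _; rewrite eqAmod_sym.
Qed.

(** The prime [q] is unramified in the [n]-th cyclotomic field: by the trace expansion, a power of
    the Frobenius with [q ^ i] congruent to 1 modulo [n] fixes [x *+ n] modulo [q]. So a nilpotent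
    class modulo [q] is zero, [n] being invertible there. *)
Lemma radical_unramified (q : nat) n k z x :
  prime q -> coprime q n -> n.-primitive_root z -> in_cyclotomic z x ->
  x \in Aint -> (q %| x ^+ k)%A -> (q %| x)%A.
Proof.
move=> q_pr q_n z_prim x_z xA xk; have n_gt0 := prim_order_gt0 z_prim.
have zA := Aint_prim_root z_prim.
have [t tZ Dx] := trace_expansion z_prim x_z xA.
have tA j : t j \in Aint by apply: Aint_Cint.
have xnA : x *+ n \in Aint by rewrite rpredMn.
have frob i : ((x *+ n) ^+ (q ^ i) ==
    \sum_(j < n) t j * z ^+ (j * q ^ i) %[mod q])%A.
  elim: i => [|i IHi]; first by rewrite expr1 Dx; under [X in eqAmod _ _ X]eq_bigr do rewrite muln1.
  rewrite expnSr exprM.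
  have sA : \sum_(j < n) t j * z ^+ (j * q ^ i) \in Aint.
    by rewrite rpred_sum // => j _; rewrite rpredM ?rpredX.
  apply: (eqAmod_trans (eqAmodX _ _ _ IHi)); rewrite ?rpredX //.
  apply: eqAmod_trans (eqAmod_expr_sum _ q_pr _) _ => [j|].
    by rewrite rpredM ?rpredX.
  apply: eqAmod_sum => j _; rewrite exprMn -exprM mulnA.
  by apply: eqAmodMr; rewrite ?rpredX // eqAmod_fermat.
(* The totient makes [q ^ i] congruent to 1 modulo [n], and the factor [k] makes [q ^ i] at least
   [k]. *)
pose i := (totient n * k)%N.
have qi1 : q ^ i = 1 %[mod n].
  by rewrite expnM -modnXm Euler_exp_totient // modnXm exp1n.
have k_le : (k <= q ^ i)%N.
  apply: leq_trans (ltnW (ltn_expl k (prime_gt1 q_pr))) _.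
  by rewrite leq_exp2l ?prime_gt1 // leq_pmull // totient_gt0.
have xn_dvd : (q %| x *+ n)%A.
  rewrite -eqAmod0 Dx.
  have -> : \sum_(j < n) t j * z ^+ j = \sum_(j < n) t j * z ^+ (j * q ^ i).
    apply: eq_bigr => j _; rewrite -(prim_expr_mod z_prim (j * _)).
    by rewrite -modnMmr qi1 modnMmr muln1 (prim_expr_mod z_prim).
  rewrite -(eqAmod_transl _ (frob i)) eqAmod0 -mulr_natr exprMn.
  rewrite dvdA_mulr ?rpredX ?rpred_nat // -(subnKC k_le) exprD.
  by rewrite dvdA_mulr ?rpredX.
have [a b ab _] := egcdnP q n_gt0.
have {ab} ab : (a * n = b * q + 1)%N by rewrite ab gcdnC (eqP q_n).
have -> : x = (x *+ n) *+ a - q%:R * (x *+ b).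
  rewrite -mulrnA mulnC ab mulrnDr mulr1n mulrnA mulr_natl.
  by rewrite addrAC subrr add0r.
by apply: rpredB; [apply: rpredMn | apply: dvdA_nat_mulr; apply: rpredMn].
Qed.

(* Relative traces t_j of [x / z_q ^ j] down to the unramified field are all
   congruent modulo a prime above [q], hence modulo [q]; and
   [q x = sum_j t_j z_q ^ j = sum_j (t_j - t_0) z_q ^ j]. *)
Lemma tame_inertia (q : nat) m z x (u : {rmorphism algC -> algC}) :
  prime q -> (0 < m)%N -> coprime q m -> (q * m).-primitive_root z ->
  in_cyclotomic z x -> x \in Aint -> u (z ^+ q) = z ^+ q ->
  (q %| (u x - x) ^+ q)%A.
Proof.
move=> q_pr m_gt0 q_m z_prim x_z xA uz; have q_gt0 := prime_gt0 q_pr.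
have qm_gt0 : (0 < q * m)%N by rewrite muln_gt0 q_gt0.
have zn := prim_expr_order z_prim.
have zq_prim : q.-primitive_root (z ^+ m).
  by apply: exp_prim_root_mul; rewrite mulnC.
set w := z ^+ m in zq_prim; have wq := prim_expr_order zq_prim.
have wqm : w ^+ (q * m) = 1 by rewrite exprM wq expr1n.
have wA : w \in Aint := Aint_prim_root zq_prim.
have w_n0 : w != 0 by rewrite (prim_root_eq0 zq_prim) -lt0n.
have wj_n0 j : w ^+ j != 0 by apply: expf_neq0.
have w_z : in_cyclotomic z w by apply: in_cyclotomic_exp.
have wV j : w ^- j = w ^+ (q.-1 * j).
  apply: (mulfI (wj_n0 j)); rewrite /= divff // -exprD.
  by rewrite -mulSn prednK // exprM wq expr1n.
(* This generates the prime above [q] in the field of [q]-th roots of unity; the Frobenius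
   congruence for [lam + w = 1] gives that [q] divides [lam ^+ q]. *)
pose lam := 1 - w.
have lamA : lam \in Aint by rewrite rpredB.
have lam_q : (q %| lam ^+ q)%A.
  have := eqAmod_exprD q_pr lamA wA; rewrite subrK wq expr1n eqAmod_sym.
  by rewrite -{2}[1 : algC]add0r eqAmodDr eqAmod0.
have lam_w i j : exists2 a, a \in Aint & w ^+ i - w ^+ j = lam * a.
  suff lam1 l : exists2 a, a \in Aint & 1 - w ^+ l = lam * a.
    have [a aA Da] := lam1 i; have [b bA Db] := lam1 j.
    by exists (b - a); rewrite ?rpredB // mulrBr -Da -Db opprB [RHS]addrC addrA subrK.
  exists (\sum_(i < l) w ^+ i); first by rewrite rpred_sum // => k _; rewrite rpredX.
  by rewrite -opprB subrX1 -mulNr opprB.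
pose t j := rel_trace q m (x * w ^- j).
have xj_z j : in_cyclotomic z (x * w ^- j).
  by rewrite wV -exprM; apply: in_cyclotomicM => //; apply: in_cyclotomic_exp.
have t_in j : in_cyclotomic (z ^+ q) (t j) by apply: rel_trace_in.
have tA j : t j \in Aint.
  by rewrite rpred_sum // => k _; rewrite Aint_aut rpredM // wV rpredX.
have tB j : exists2 a, a \in Aint & t j - t 0 = q%:R * a.
  have [a aA Da] : exists2 a, a \in Aint & t j - t 0 = lam * a.
    rewrite -sumrB; elim/big_rec: _ => [|k s /andP[_ k_co] [a aA ->]].
      by exists 0; rewrite ?mulr0.
    rewrite expr0 invr1 mulr1 rmorphM -{2}[aut_pow _ _ x]mulr1 -mulrBr.
    rewrite wV rmorphXn /= (aut_powE k_co wqm) -exprM -[X in _ - X](expr0 w).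
    have [b bA ->] := lam_w (k * (q.-1 * j))%N 0%N.
    exists (aut_pow (q * m) k x * b + a); first by rewrite rpredD ?rpredM ?Aint_aut.
    by rewrite mulrDr mulrCA.
  (* The difference lies in Q(z^q), where [q] is unramified, and its [q]-th power is a multiple of
     [lam ^+ q], hence of [q]. *)
  have : (q %| t j - t 0)%A.
    apply: (radical_unramified q_pr q_m (exp_prim_root_mul z_prim)) (_ : _ %| _ ^+ q)%A.
    - by apply: in_cyclotomicD => //; apply: in_cyclotomicN.
    - by rewrite rpredB.
    by rewrite Da exprMn dvdA_mulr ?rpredX.
  rewrite unfold_in pnatr_eq0 gtn_eqF // => tqA.
  by exists ((t j - t 0) / q%:R) => //; rewrite mulrCA divff ?mulr1 // pnatr_eq0 gtn_eqF.
have Dx : q%:R * x = \sum_(j < q) (t j - t 0) * w ^+ j.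
  have -> : \sum_(j < q) (t j - t 0) * w ^+ j = \sum_(j < q) t j * w ^+ j.
    under eq_bigr do rewrite mulrBl; rewrite sumrB -mulr_sumr.
    rewrite geometric_root_sum ?mulr0 ?subr0 //.
    apply: contraTneq (prime_gt1 q_pr) => w1.
    by rewrite -leqNgt dvdn_leq // (prim_order_dvd zq_prim) expr1 w1.
  rewrite /t /rel_trace; under eq_bigr do rewrite mulr_suml.
  rewrite exchange_big /= (bigD1 (Ordinal (ltn_pmod 1 qm_gt0))) ?rel_exp1 //=.
  rewrite [X in _ + X]big1 ?addr0 => [|k /andP[/andP[k_m k_co] k_n1]].
    rewrite (eq_bigr (fun=> x)) ?sumr_const ?card_ord ?mulr_natl // => j _.
    by rewrite (aut_pow1 z_prim) ?divfK.
  under eq_bigr => j _ do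
    rewrite rmorphM fmorphV rmorphXn /= -mulrA (aut_powE k_co wqm) -exprVn -exprMn.
  rewrite -mulr_sumr geometric_root_sum ?mulr0 //.
    by rewrite exprMn exprVn -exprM mulnC exprM wq expr1n invr1 mulr1.
  apply: contraNneq k_n1 => wk1.
  have /eqP : w ^+ k = w ^+ 1.
    by rewrite -[LHS]mulr1 -wk1 mulVKf.
  rewrite (eq_prim_root_expr zq_prim) => k_q.
  have : k == 1 %[mod q * m] by rewrite chinese_remainder // k_q.
  by rewrite modn_small.
have [c _ uw] := aut_prim_rootP u zq_prim.
have q_n0 : q%:R != 0 :> algC by rewrite pnatr_eq0 gtn_eqF.
(* In the expansion of [q%:R * (u x - x)], the coefficients [t j - t 0] are fixed by [u] and
   divisible by [q], and the differences of powers of [w] are divisible by [lam]; it remains to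
   cancel [q]. *)
suff [a aA ->] : exists2 a, a \in Aint & u x - x = lam * a.
  by rewrite exprMn dvdA_mulr ?rpredX.
have uzt j : u (t j - t 0) = t j - t 0.
  apply: (in_cyclotomic_eq_aut (v := idfun) _ uz).
  by apply: in_cyclotomicD => //; apply: in_cyclotomicN.
have : q%:R * (u x - x) = \sum_(j < q) (t j - t 0) * (w ^+ (c * j) - w ^+ j).
  rewrite mulrBr -{1}(rmorph_nat u) -rmorphM Dx rmorph_sum -sumrB.
  apply: eq_bigr => j _; rewrite rmorphM /= uzt -mulrBr; congr (_ * (_ - _)).
  by rewrite rmorphXn /= uw exprM.
have {Dx} [a aA ->] : exists2 a, a \in Aint &
    \sum_(j < q) (t j - t 0) * (w ^+ (c * j) - w ^+ j) = q%:R * (lam * a).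
  elim/big_rec: _ => [|j s _ [a aA ->]]; first by exists 0; rewrite ?mulr0.
  have [b bA ->] := tB j; have [d dA ->] := lam_w (c * j)%N j.
  by exists (b * d + a); rewrite ?rpredD ?rpredM // -mulrA -mulrDr [b * _]mulrCA -mulrDr.
by move/(mulfI q_n0) => ->; exists a.
Qed.

(** * Integral bases and discriminants *)

Lemma polyOver1_rat (K : splittingFieldType rat) (P : {poly K}) :
  P \is a polyOver 1%VS -> exists Q : {poly rat}, P = map_poly (in_alg K) Q.
Proof.
move=> /polyOverP P1; have P1' i : exists c : rat, P`_i = c%:A by apply/vlineP.
have [c Pc] := choice P1'.
exists (\poly_(i < size P) c i); apply/polyP => i.
rewrite coef_map coef_poly /=; case: ltnP => [_|le_i].
  exact: Pc.
by rewrite scale0r nth_default.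
Qed.

(** A primitive element [a] is sent to a complex root [z] of its minimal polynomial. A polynomial
    expression in [a] is chosen for each element; [vanish] shows that the image does not depend on
    this choice, whence additivity and multiplicativity. *)
Lemma embedding_exists (K : splittingFieldType rat) :
  galois 1 {:K} -> exists f : {rmorphism K -> algC}, True.
Proof.
case/and3P=> _ K_sep _.
have Ka := eq_adjoin_separable_generator K_sep (sub1v _).
set a := separable_generator _ _ in Ka.
have [Q DQ] := polyOver1_rat (minPolyOver 1 a).
have [z Qz] : exists z : algC, root (map_poly ratr Q) z.
  apply/closed_rootP; rewrite size_map_poly -(size_map_poly (in_alg K)) -DQ.
  rewrite gtn_eqF //; apply: root_size_gt1 (root_minPoly 1 a).
  exact/monic_neq0/monic_minPoly.
have vanish (P : {poly rat}) :
    (map_poly (in_alg K) P).[a] = 0 -> (map_poly ratr P).[z] = 0 :> algC.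
  move/eqP; rewrite -/(root _ _) => Pa.
  have : minPoly 1 a %| map_poly (in_alg K) P.
    apply: minPoly_dvdp => //; apply/polyOverP => i.
    by rewrite coef_map /= rpredZ ?mem1v.
  rewrite DQ dvdp_map => /dvdpP[R ->].
  by rewrite rmorphM hornerM (eqP Qz) mulr0.
have rep x : exists P : {poly rat}, x = (map_poly (in_alg K) P).[a].
  have : x \in <<1; a>>%VS by rewrite -Ka memvf.
  case/Fadjoin_polyP => R /polyOver1_rat[P ->] ->; by exists P.
pose P_ x := projT1 (cid (rep x)).
have P_E x : x = (map_poly (in_alg K) (P_ x)).[a] := projT2 (cid (rep x)).
pose g x : algC := (map_poly ratr (P_ x)).[z].
have g_add : zmod_morphism g.
  move=> x y; apply/eqP; rewrite /g -subr_eq0.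
  rewrite -[- (_).[z]]hornerN -!hornerD -hornerN -hornerD -rmorphN -rmorphD -rmorphN -rmorphD.
  apply/eqP/vanish; rewrite !(rmorphD, rmorphN, hornerD, hornerN) -!P_E.
  by rewrite subrr.
have g_mul : monoid_morphism g.
  rewrite /g; split=> [|x y]; apply/eqP; rewrite -subr_eq0.
    have -> : 1 = (map_poly ratr (1 : {poly rat})).[z] :> algC by rewrite rmorph1 hornerC.
    rewrite -hornerN -hornerD -rmorphN -rmorphD; apply/eqP/vanish.
    by rewrite !(rmorphD, rmorphN, hornerD, hornerN) -!P_E rmorph1 hornerC subrr.
  rewrite -hornerM -hornerN -hornerD -rmorphM -rmorphN -rmorphD.
  apply/eqP/vanish; rewrite !(rmorphD, rmorphN, rmorphM, hornerD, hornerN, hornerM).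
  by rewrite -!P_E subrr.
pose gaM := GRing.isZmodMorphism.Build _ _ g g_add.
pose gmM := GRing.isMonoidMorphism.Build _ _ g g_mul.
by exists (HB.pack g gaM gmM : {rmorphism K -> algC}).
Qed.

Lemma integers_Aint (K : splittingFieldType rat) (f : {rmorphism K -> algC}) x :
  integers x <-> f x \in Aint.
Proof.
split=> [[p p_mon px]|].
  apply: (@root_monic_Aint (map_poly intr p)).
  - have -> : map_poly intr p = map_poly f (map_poly intr p).
      by rewrite -map_poly_comp; apply: eq_map_poly => i /=; rewrite rmorph_int.
    by rewrite fmorph_root.
  - exact: monic_map.
  by apply/polyOverP => i; rewrite coef_map /= intr_int.
move=> fxA; have /floorpP[p Dp] : minCpoly (f x) \is a polyOver Num.int := fxA.
exists p.
  apply/monicP/(@intr_inj algC); rewrite -(lead_coef_map_inj (@intr_inj algC)) ?rmorph0 //.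
  by rewrite -Dp (monicP (minCpoly_monic _)).
rewrite -(fmorph_root f) -map_poly_comp.
have -> : map_poly (f \o intr) p = minCpoly (f x).
  by rewrite Dp; apply: eq_map_poly => i /=; rewrite rmorph_int.
exact: root_minCpoly.
Qed.

Lemma integers_scale (K : splittingFieldType rat) (f : {rmorphism K -> algC}) (x : K) :
  exists2 N : int, N != 0 & integers (x *~ N).
Proof.
have [Q [DQ Q_mon _]] := minCpolyP (f x).
have [q [a a_n0 Dq]] := rat_poly_scale Q.
have q_n0 : q != 0.
  apply: contraNneq (monic_neq0 Q_mon) => q0.
  by rewrite Dq q0 rmorph0 scaler0.
exists (lead_coef q); first by rewrite lead_coef_eq0.
set c := lead_coef q.
have q_gt1 : (1 < size q)%N.
  rewrite -(size_map_inj_poly (@intr_inj rat)) ?rmorph0 //.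
  rewrite -(size_scale (map_poly intr q) (_ : a%:~R^-1 != 0)) ?invr_eq0 ?intr_eq0 // -Dq.
  by rewrite -(size_map_poly (ratr : rat -> algC)) -DQ size_minCpoly.
have [d Dsz] : exists d, size q = d.+2 by case: (size q) q_gt1 => [|[|d]] // _; exists d.
have qx : \sum_(i < d.+2) (q`_i)%:~R * f x ^+ i = 0 :> algC.
  have : root (map_poly ratr Q) (f x) by rewrite -DQ root_minCpoly.
  rewrite Dq /root linearZ /= hornerZ mulf_eq0 fmorph_eq0 invr_eq0 intr_eq0.
  rewrite (negPf a_n0) /= -map_poly_comp (@eq_map_poly _ _ _ intr) => [|i]; last first.
    by rewrite /= rmorph_int.
  rewrite horner_coef (size_map_inj_poly intr_inj) ?rmorph0 //.
  rewrite Dsz => /eqP qx0; rewrite -[RHS]qx0.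
  by apply: eq_bigr => i _; rewrite coef_map.
apply/(integers_Aint f); rewrite rmorphMz /=.
(* This is c^d q(X/c), monic and with root [c] times [f x]. *)
pose P : {poly int} := 'X^(d.+1) + \poly_(i < d.+1) (q`_i * c ^+ (d - i)).
apply: (@root_monic_Aint (map_poly intr P)).
- rewrite /root rmorphD /= map_polyXn hornerD hornerXn.
  rewrite (horner_coef_wide (n := d.+1)); last first.
    by rewrite (leq_trans (size_poly _ _)) // size_poly.
  have : c%:~R ^+ d * (\sum_(i < d.+2) (q`_i)%:~R * f x ^+ i) = 0 :> algC.
    by rewrite qx mulr0.
  rewrite big_ord_recr /= mulrDr addrC => top; rewrite -[X in _ == X]top {top}.
  have Dc : q`_d.+1 = c by rewrite /c lead_coefE Dsz.
  rewrite Dc mulrA -exprSr -exprMn mulrzl mulr_sumr; apply/eqP; congr (_ + _).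
  apply: eq_bigr => i _; rewrite coef_map coef_poly ltn_ord /= -[f x *~ c]mulrzl exprMn.
  rewrite rmorphM rmorphXn /= -!mulrA [RHS]mulrCA; congr (_ * _).
  by rewrite mulrA -exprD subnK // -ltnS.
- apply: monic_map; rewrite monicE lead_coefDl ?lead_coefXn //.
  by rewrite size_polyXn ltnS size_poly.
by apply/polyOverP => i; rewrite coef_map /= intr_int.
Qed.

Lemma gal_all (K : splittingFieldType rat) (x : gal_of {:K}) :
  x \in 'Gal({:K} / 1)%g.
Proof. by rewrite gal_kHom ?sub1v // k1AHom. Qed.

(** Indexing the Galois group by the same ordinals as a basis makes the matrix of conjugates
    square. *)
Lemma gal_enum (K : splittingFieldType rat) :
  galois 1 {:K} ->
  exists2 s : 'I_(\dim {:K}) -> gal_of {:K}, bijective s &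
    forall a, galTrace 1 {:K} a = \sum_i s i a.
Proof.
move=> gK; have card_gal : #|{: gal_of {:K}}| = \dim {:K}.
  have := galois_dim gK; rewrite dimv1 divn1 => ->.
  by apply: eq_card => x; rewrite !inE gal_all.
have s_bij : bijective (enum_val \o cast_ord (esym card_gal)
    : 'I_(\dim {:K}) -> gal_of {:K}).
  apply: bij_comp; first exact: enum_val_bij.
  by exists (cast_ord card_gal) => i; rewrite ?cast_ordK ?cast_ordKV.
exists (enum_val \o cast_ord (esym card_gal)) => // a.
rewrite /galTrace (reindex _ (onW_bij _ s_bij)) /=.
by apply: eq_bigl => i; rewrite gal_all.
Qed.

Definition conj_mx (K : splittingFieldType rat) n (s : 'I_n -> gal_of {:K})
  (b : n.-tuple K) : 'M[K]_n := \matrix_(i, j) s j (tnth b i).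

Lemma trace_mxE (K : splittingFieldType rat) n (s : 'I_n -> gal_of {:K}) b :
  (forall a, galTrace 1 {:K} a = \sum_i s i a) ->
  \matrix_(i, j) galTrace 1 {:K} (tnth b i * tnth b j) =
    conj_mx s b *m (conj_mx s b)^T.
Proof.
move=> s_tr; apply/matrixP => i j; rewrite !mxE s_tr.
by apply: eq_bigr => k _; rewrite !mxE rmorphM.
Qed.

Lemma det_trace_mx (K : splittingFieldType rat) n (s : 'I_n -> gal_of {:K}) b :
  (forall a, galTrace 1 {:K} a = \sum_i s i a) ->
  \det (\matrix_(i, j) galTrace 1 {:K} (tnth b i * tnth b j)) =
    \det (conj_mx s b) ^+ 2.
Proof. by move=> s_tr; rewrite (trace_mxE _ s_tr) det_mulmx det_tr. Qed.

(** A kernel vector on the side of the automorphisms contradicts Dedekind's independence of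
    automorphisms; a linear relation between the [b] gives a kernel vector on the other side. *)
Lemma det_conj_mx_neq0 (K : splittingFieldType rat)
    (s : 'I_(\dim {:K}) -> gal_of {:K}) (b : (\dim {:K}).-tuple K) :
  bijective s -> basis_of {:K} b <-> \det (conj_mx s b) != 0.
Proof.
move=> [t st ts]; split=> [b_basis|det_n0].
  apply/negP; rewrite -det_tr => /det0P[v v_n0 vM].
  have vb i : \sum_k v 0 k * s k (tnth b i) = 0.
    have := congr1 (fun A : 'rV_(\dim {:K}) => A 0 i) vM; rewrite !mxE => vMi.
    by rewrite -[RHS]vMi; apply: eq_bigr => k _; rewrite !mxE.
  case/negP: v_n0; apply/eqP/rowP => k; rewrite mxE.
  rewrite -[k]st; apply: (@gal_independent _ _ {:K} predT (fun y => v 0 (t y))) => // a _.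
  rewrite (reindex s) /=; last by exists t => x _.
  rewrite (coord_basis b_basis (memvf a)).
  under eq_bigr do rewrite st linear_sum mulr_sumr.
  rewrite exchange_big big1 //= => i _.
  under eq_bigr do rewrite linearZ /= -scalerAr -tnth_nth.
  by rewrite -scaler_sumr vb scaler0.
rewrite basisEfree subvf size_tuple leqnn /= andbT.
apply/freeP => c cb i; apply/eqP; apply: contraNT det_n0 => ci.
apply/det0P; exists (\row_i (c i)%:A).
  by apply: contraNneq ci => /rowP/(_ i); rewrite !mxE => /eqP; rewrite scaler_eq0 oner_eq0 orbF.
apply/rowP => j; rewrite !mxE; transitivity (s j (\sum_(i < \dim {:K}) c i *: b`_i)).
  rewrite linear_sum; apply: eq_bigr => k _.
  by rewrite !mxE linearZ /= (tnth_nth 0) mulr_algl.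
by rewrite cb linear0.
Qed.

(** Cramer's rule: the cofactors along row [k] are common to [A] and [B], and [A *m \adj A] is
    scalar. *)
Lemma det_row_comb (R : comNzRingType) n (A B : 'M[R]_n) (c : 'I_n -> R) k :
  (forall i j, i != k -> B i j = A i j) ->
  (forall j, B k j = \sum_i c i * A i j) -> \det B = c k * \det A.
Proof.
move=> BA Bk; rewrite (expand_det_row _ k).
transitivity (\sum_i c i * (A *m \adj A) i k); last first.
  rewrite mul_mx_adj (bigD1 k) //= mxE eqxx big1 ?addr0 // => i ik.
  by rewrite mxE (negPf ik) mulr0.
under eq_bigr do rewrite Bk mulr_suml.
rewrite exchange_big; apply: eq_bigr => i _ /=; rewrite mxE mulr_sumr.
apply: eq_bigr => j _; rewrite mxE -mulrA; congr (_ * (_ * (_ * \det _))).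
by apply/matrixP => l m; rewrite !mxE BA // eq_sym neq_lift.
Qed.

Lemma integers_gal (K : splittingFieldType rat) (s : gal_of {:K}) x :
  integers x -> integers (s x).
Proof.
move=> [p p_mon px]; exists p => //.
have -> : map_poly intr p = map_poly s (map_poly intr p).
  by rewrite -map_poly_comp; apply: eq_map_poly => i /=; rewrite rmorph_int.
by rewrite fmorph_root.
Qed.

Lemma integers_trace (K : splittingFieldType rat) (f : {rmorphism K -> algC}) x :
  galois 1 {:K} -> integers x -> exists d : int, galTrace 1 {:K} x = d%:~R.
Proof.
move=> gK xZ; have /vlineP[a Da] := mem_galTrace gK (memvf x).
have : f (galTrace 1 {:K} x) \in Num.int.
  apply: Cint_rat_Aint; last first.
    rewrite /galTrace rmorph_sum rpred_sum // => s _.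
    exact/integers_Aint/integers_gal.
  by rewrite Da alg_num_field fmorph_rat; apply/CratP; exists a.
by case/intrP => d Dd; exists d; apply: (fmorph_inj f); rewrite rmorph_int.
Qed.

Lemma integers_disc (K : splittingFieldType rat) n (b : n.-tuple K) :
  galois 1 {:K} -> (forall i, integers (tnth b i)) -> exists d : int,
  \det (\matrix_(i, j) galTrace 1 {:K} (tnth b i * tnth b j)) = d%:~R.
Proof.
move=> gK bZ; have [f _] := embedding_exists gK.
have ex (ij : 'I_n * 'I_n) : exists d : int,
    galTrace 1 {:K} (tnth b ij.1 * tnth b ij.2) = d%:~R.
  apply: (integers_trace f gK).
  by apply/(integers_Aint f); rewrite rmorphM rpredM //; apply/integers_Aint.
have [t Dt] := choice ex.
exists (\det (\matrix_(i, j) t (i, j))); rewrite -det_map_mx; congr (\det _).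
by apply/matrixP => i j; rewrite !mxE; apply: (Dt (i, j)).
Qed.

Lemma intr_alg_eq0 (K : fieldExtType rat) (d : int) :
  (d%:~R == 0 :> K) = (d == 0).
Proof. by rewrite -(rmorph_int (in_alg K)) fmorph_eq0 intr_eq0. Qed.

(** Among the bases made of integers, one with least absolute discriminant is integral: if an
    integer [x] had a coordinate with fractional part [r] in ]0,1[, putting [x'] in place of that
    basis vector would multiply the discriminant by [r ^+ 2]. *)
Lemma integral_basis_exists (K : splittingFieldType rat) :
  galois 1 {:K} -> exists b : (\dim {:K}).-tuple K, integral_basis b.
Proof.
move=> gK; have [f _] := embedding_exists gK.
have [s s_bij s_tr] := gal_enum gK.
pose T (b : (\dim {:K}).-tuple K) :=
  \matrix_(i, j) galTrace 1 {:K} (tnth b i * tnth b j).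
pose P m := exists b : (\dim {:K}).-tuple K, exists d : int,
  [/\ basis_of {:K} b, forall i, integers (tnth b i), \det (T b) = d%:~R & `|d|%N = m].
have [m0 Pm0] : exists m, P m.
  have /choice[N NP] i : exists N : int, N != 0 /\ integers (tnth (vbasis {:K}) i *~ N).
    by have [N] := integers_scale f (tnth (vbasis {:K}) i); exists N.
  pose b := [tuple tnth (vbasis {:K}) i *~ N i | i < \dim {:K}].
  have bZ i : integers (tnth b i) by rewrite tnth_mktuple; case: (NP i).
  have [d Dd] := integers_disc gK bZ.
  exists `|d|%N, b, d; split=> //; apply/(det_conj_mx_neq0 _ s_bij).
  have -> : conj_mx s b = diag_mx (\row_i (N i)%:~R) *m conj_mx s (vbasis {:K}).
    apply/matrixP => i j; rewrite mul_diag_mx !mxE tnth_mktuple.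
    by rewrite rmorphMz /= mulrzl.
  rewrite det_mulmx det_diag mulf_neq0 //.
    by apply/prodf_neq0 => i _; rewrite mxE intr_alg_eq0; case: (NP i).
  by apply/(det_conj_mx_neq0 _ s_bij)/vbasisP.
have exP : exists m, `[< P m >] by exists m0; apply/asboolP.
case: (ex_minnP exP) => m /asboolP[b [d [b_basis bZ Dd dm]]] m_min.
exists b; split=> // x xZ.
pose c i := coord b i x.
have Dx : x = \sum_i c i *: tnth b i.
  rewrite {1}(coord_basis b_basis (memvf x)).
  by apply: eq_bigr => i _; rewrite -tnth_nth.
suff cZ i : c i \is a Num.int.
  have /choice[e De] i : exists e : int, c i = e%:~R by apply/intrP/cZ.
  by exists e; rewrite {1}Dx; apply: eq_bigr => i _; rewrite De scaler_int.
apply/negPn/negP => ciN.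
pose r := c i - (Num.floor (c i))%:~R.
have r_gt0 : 0 < r.
  rewrite subr_gt0 lt_neqAle floor_le andbT.
  by apply: contra ciN => /eqP <-; apply: intr_int.
have r_lt1 : r < 1 by rewrite ltrBlDl -[X in _ + X]/(1%:~R) -intrD floorD1_gt.
pose x' := x - tnth b i *~ Num.floor (c i).
pose b' := [tuple if j == i then x' else tnth b j | j < \dim {:K}].
have b'Z j : integers (tnth b' j).
  rewrite tnth_mktuple; case: eqP => // _; apply/(integers_Aint f).
  rewrite rmorphB rmorphMz rpredB ?rpredMz //; first exact/integers_Aint.
  by apply/integers_Aint/bZ.
have det_b' : \det (conj_mx s b') = r%:A * \det (conj_mx s b).
  rewrite (@det_row_comb _ _ (conj_mx s b) _ (fun j => (if j == i then r else c j)%:A) i) ?eqxx //.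
    by move=> j k /negPf ji; rewrite !mxE tnth_mktuple ji.
  move=> k; rewrite !mxE tnth_mktuple eqxx.
  transitivity (s k (\sum_j (if j == i then r else c j) *: tnth b j)).
    congr (s k _); rewrite /x' {1}Dx (bigD1 i) //= [RHS](bigD1 i) //= eqxx.
    rewrite addrAC -scaler_int -scalerBl; congr (_ + _).
    by apply: eq_bigr => j /negPf ->.
  by rewrite linear_sum; apply: eq_bigr => j _; rewrite mxE mulr_algl linearZ.
have [d' Dd'] := integers_disc gK b'Z.
have dd' : d'%:~R = r ^+ 2 * d%:~R :> rat.
  apply: (fmorph_inj (in_alg K)); rewrite rmorphM rmorphXn !rmorph_int /=.
  by rewrite -Dd' -Dd !(det_trace_mx _ s_tr) det_b' exprMn.
have b'_basis : basis_of {:K} b'.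
  apply/(det_conj_mx_neq0 _ s_bij); rewrite det_b' mulf_neq0 //.
    by rewrite scaler_eq0 oner_eq0 orbF gt_eqF.
  exact/(det_conj_mx_neq0 _ s_bij).
have : (m <= `|d'|)%N by apply: m_min; apply/asboolP; exists b', d'.
have d_n0 : d != 0.
  rewrite -(intr_alg_eq0 K) -Dd (det_trace_mx _ s_tr) expf_neq0 //.
  exact/(det_conj_mx_neq0 _ s_bij).
apply/negP; rewrite -ltnNge -dm -(ltr_nat rat) !natr_absz.
rewrite !intr_norm dd' normrM gtr_pMl ?normr_gt0 ?intr_eq0 //.
by rewrite ger0_norm ?exprn_ge0 ?ltW // expr_lt1 // ?ltW.
Qed.

Lemma discriminantP (K : splittingFieldType rat) :
  galois 1 {:K} -> is_discriminant K (discriminant K) /\ discriminant K != 0.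
Proof.
move=> gK; suff disc : is_discriminant K (discriminant K).
  split=> //; have [s s_bij s_tr] := gal_enum gK.
  have [b [[b_basis _ _] Db]] := disc.
  rewrite -(intr_alg_eq0 K) -Db (det_trace_mx _ s_tr) expf_neq0 //.
  exact/(det_conj_mx_neq0 _ s_bij).
have [b bP] := integral_basis_exists gK.
have [d Dd] := integers_disc gK (fun i => let: And3 _ bZ _ := bP in bZ i).
rewrite /discriminant; case: xgetP => [d' -> //|/(_ d)]; case.
by exists b.
Qed.

(** * Primes dividing the conductor *)

Lemma Aint_det n (A : 'M[algC]_n) :
  (forall i j, A i j \in Aint) -> \det A \in Aint.
Proof.
move=> AA; rewrite /determinant rpred_sum // => s _.
by rewrite rpredMsign rpred_prod.
Qed.

(* Two columns of the matrix of conjugates of an integral basis agree modulo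
   the radical of [q], so its determinant, a square root of the discriminant,
   lies in this radical. *)
Lemma inertia_dvd_disc (K : splittingFieldType rat) (f : {rmorphism K -> algC})
    (s1 : gal_of {:K}) (u : {rmorphism algC -> algC}) (q : nat) (d : int) :
  galois 1 {:K} -> prime q -> s1 != 1%g -> (forall x, f (s1 x) = u (f x)) ->
  (forall x, integers x -> (q %| (u (f x) - f x) ^+ q)%A) ->
  is_discriminant K d -> (q %| `|d|)%N.
Proof.
move=> gK q_pr s1_n1 s1u uZ [b [[_ bZ _] Dd]].
have [s [t st ts] s_tr] := gal_enum gK.
have bA i j : f (s j (tnth b i)) \in Aint by apply/integers_Aint/integers_gal.
(* The transposed matrix of conjugates, with the row of the identity subtracted from that of [s1];
   as [s1 != 1%g] the determinant is unchanged. *)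
pose M := \matrix_(i, j) (if i == t s1 then
  u (f (tnth b j)) - f (tnth b j) else f (s i (tnth b j))).
have detM : \det M = f (\det (conj_mx s b)).
  rewrite -(det_tr (conj_mx s b)) -det_map_mx.
  rewrite (@det_row_comb _ _ (map_mx f (conj_mx s b)^T) M
    (fun i => (i == t s1)%:R - (i == t 1%g)%:R) (t s1)).
  - by rewrite eqxx (inj_eq (can_inj ts)) (negPf s1_n1) subr0 mul1r.
  - by move=> i j /negPf ij; rewrite !mxE ij.
  move=> j; rewrite mxE eqxx; under eq_bigr do rewrite !mxE mulrBl.
  rewrite sumrB (bigD1 (t s1)) //= [X in _ = _ - X](bigD1 (t 1%g)) //= !eqxx !mul1r !ts gal_id s1u.
  by rewrite !big1 ?addr0 // => i /negPf ->; rewrite mul0r.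
have MA i j : M i j \in Aint.
  rewrite mxE; case: eqP => // _; rewrite -s1u rpredB //.
    by rewrite -[s1]ts.
  exact/integers_Aint/bZ.
have detMA : \det M \in Aint by apply: Aint_det.
have detMq : (q %| \det M ^+ q)%A.
  have cA j : cofactor M (t s1) j \in Aint.
    rewrite rpredMsign; apply: Aint_det => i k.
    by have := MA (lift (t s1) i) (lift j k); rewrite !mxE.
  rewrite -eqAmod0 (expand_det_row M (t s1)).
  apply: eqAmod_trans (eqAmod_expr_sum _ q_pr _) _ => [j|].
    by rewrite rpredM.
  rewrite eqAmod0 rpred_sum // => j _; rewrite exprMn dvdA_mulr ?rpredX //.
  by rewrite mxE eqxx uZ.
(* The [q]-th power comes from the hypothesis on [u], and the even exponent removes the absolute
   value. *)
have : (q %| (`|d| ^ (2 * q))%:R)%A.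
  rewrite natrX natr_absz intr_norm exprM real_normK ?realz //.
  have -> : d%:~R = \det M ^+ 2.
    by rewrite detM -rmorphXn -(det_trace_mx _ s_tr) Dd rmorph_int.
  have -> : ((\det M ^+ 2) ^+ 2) ^+ q = \det M ^+ q * \det M ^+ (3 * q).
    by rewrite -exprD -mulSn -exprM -exprM mulnA.
  by rewrite dvdA_mulr ?rpredX.
by rewrite -eqAmod0 eqAmod0_nat Euclid_dvdX // => /andP[].
Qed.

(** Since [K] is normal over the rationals, [u] preserves the image of [f]. *)
Lemma gal_of_aut (K : splittingFieldType rat) (f : {rmorphism K -> algC})
    (u : {rmorphism algC -> algC}) :
  exists s : gal_of {:K}, forall x, f (s x) = u (f x).
Proof.
have [v Dv] := restrict_aut_to_normal_num_field f u.
have v_aut : kAut 1 {:K} (linfun v).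
  rewrite kAutfE; apply/kHom_monoid_morphism; split=> [|x y]; rewrite !(lfunE v) /=.
    exact: rmorph1.
  exact: rmorphM.
have [s _ Ds] := kAut_to_gal v_aut.
by exists s => x; rewrite -Ds ?memvf // lfunE Dv.
Qed.

Lemma gal_expE (K : splittingFieldType rat) (s : gal_of {:K}) k x :
  (s ^+ k)%g x = iter k s x.
Proof.
elim: k x => [|k IHk] x; first by rewrite gal_id.
by rewrite expgSr galM ?memvf // IHk.
Qed.

Lemma conductor_dvd_disc (p q : nat) (K : splittingFieldType rat) :
  galois 1 {:K} -> \dim {:K} = p -> prime p -> prime q -> q != p ->
  q \in primes (conductor K) -> (q %| `|discriminant K|)%N.
Proof.
move=> gK dimK p_pr q_pr qp; rewrite mem_primes => /and3P[_ m_gt0 /dvdnP[m Dm]].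
have [_ [f [z [z_prim f_z]]] m_min] : is_conductor K (conductor K).
  by move: m_gt0; rewrite /conductor; case: xgetP.
move: m_gt0; rewrite Dm mulnC in z_prim m_min * => m_gt0.
have {}m_gt0 : (0 < m)%N by move: m_gt0; rewrite muln_gt0 => /andP[].
(* Otherwise descent would embed [K] in the [m]-th cyclotomic field, with [m] smaller than the
   conductor. *)
have [u [uz [x ux]]] : exists u : {rmorphism algC -> algC},
    u (z ^+ q) = z ^+ q /\ exists x, u (f x) <> f x.
  apply: contrapT => no_u; suff : (q * m <= m)%N.
    by rewrite leqNgt ltn_Pmull ?prime_gt1.
  apply: m_min => //; exists f, (z ^+ q); split; first exact: exp_prim_root_mul z_prim.
  move=> x; apply: (in_cyclotomic_descent q_pr m_gt0 z_prim (f_z x)) => u uz.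
  by apply: contrapT => ux; apply: no_u; exists u; split=> //; exists x.
have [s su] := gal_of_aut f u.
have s_n1 : s != 1%g.
  by apply/eqP => s1; apply: ux; rewrite -su s1 gal_id.
have [q_m|q_m] := boolP (q %| m)%N; last first.
  have [discK _] := discriminantP gK.
  apply: (inertia_dvd_disc gK q_pr s_n1 su _ discK) => y /(integers_Aint f) yA.
  by apply: (tame_inertia q_pr m_gt0 _ z_prim (f_z y)) => //; rewrite prime_coprime.
(* When [q] divides [m], the order of [s] divides both [p] and [q], which are distinct primes. *)
case/negP: s_n1; rewrite -order_eq1.
have s_p : (#[s]%g %| p)%N.
  have := galois_dim gK; rewrite dimv1 divn1 dimK => ->.
  by rewrite order_dvdG ?gal_all.
suff s_q : (#[s]%g %| q)%N.
  rewrite -dvdn1 -(_ : gcdn p q = 1%N) ?dvdn_gcd ?s_p //.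
  by apply/eqP; rewrite -/(coprime p q) prime_coprime // dvdn_prime2 // eq_sym.
rewrite order_dvdn; apply/gal_eqP => y _; rewrite gal_id gal_expE.
apply: (fmorph_inj f); have -> : f (iter q s y) = iter q u (f y).
  by elim: q {q_pr qp Dm m_min z_prim uz q_m} => //= k <-; rewrite su.
have z_n0 : z != 0 by rewrite (prim_root_eq0 z_prim) -lt0n muln_gt0 prime_gt0.
(* This quotient is a [q]-th root of unity, so a power of [z ^+ m], and of [z ^+ q] because [q]
   divides [m]. Hence [u] fixes [w], and iterating [u] [q] times multiplies [z] by [w ^+ q = 1]. *)
pose w := u z / z; have uz_w : u z = z * w by rewrite mulrCA divff ?mulr1.
have [i Dw] : exists i : nat, w = (z ^+ q) ^+ i.
  have zm_prim : q.-primitive_root (z ^+ m).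
    by apply: exp_prim_root_mul; rewrite mulnC.
  have wq : w ^+ q = 1.
    by rewrite exprMn exprVn -rmorphXn uz divff ?expf_neq0.
  have [i ->] := prim_rootP zm_prim wq; case/dvdnP: q_m => l ->.
  by exists (l * i)%N; rewrite -!exprM mulnAC mulnC !mulnA.
have uw : u w = w by rewrite Dw rmorphXn /= uz.
have iter_uz k : iter k u z = z * w ^+ k.
  elim: k => [|k IHk] /=; first by rewrite mulr1.
  by rewrite IHk rmorphM rmorphXn /= uw uz_w -mulrA -exprS.
have [P ->] := f_z y.
have -> k : iter k u (map_poly ratr P).[z] = (map_poly ratr P).[iter k u z].
  by elim: k => //= k ->; rewrite rmorph_horner_ratr.
rewrite iter_uz (_ : w ^+ q = 1) ?mulr1 //.
by rewrite exprMn exprVn -rmorphXn uz divff ?expf_neq0.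
Qed.

(** * Reduction of positive definite integral forms *)

Definition qform n (G : 'M[int]_n) (x : 'rV[int]_n) : int := (x *m G *m x^T) 0 0.

Definition posdef n (G : 'M[int]_n) : Prop :=
  G^T = G /\ forall x, x != 0 -> 0 < qform G x.

Lemma qform_congr m n (G : 'M[int]_n) (U : 'M_(m, n)) x :
  qform (U *m G *m U^T) x = qform G (x *m U).
Proof. by rewrite /qform trmx_mul !mulmxA. Qed.

Lemma mulmx_unit_neq0 n (U : 'M[int]_n) (x : 'rV[int]_n) :
  U \in unitmx -> x != 0 -> x *m U != 0.
Proof.
by move=> Uu; apply: contraNneq => xU; rewrite -(mulmxK Uu x) xU mul0mx.
Qed.

Lemma posdef_congr n (G U : 'M[int]_n) :
  U \in unitmx -> posdef G -> posdef (U *m G *m U^T).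
Proof.
move=> Uu [Gsym Gpos]; split; first by rewrite !trmx_mul trmxK Gsym mulmxA.
by move=> x x_n0; rewrite qform_congr Gpos ?mulmx_unit_neq0.
Qed.

Lemma det_congr n (G U : 'M[int]_n) :
  U \in unitmx -> \det (U *m G *m U^T) = \det G.
Proof.
move=> Uu; rewrite !det_mulmx det_tr mulrAC -expr2.
have : \det U ^+ 2 = 1.
  by move: Uu; rewrite unitmxE unfold_in => /orP[]/eqP->.
by move->; rewrite mul1r.
Qed.

(** The Schur complement of the corner entry, multiplied by this entry to stay integral. *)
Definition schur n (H : 'M[int]_(1 + n)) : 'M[int]_n :=
  H 0 0 *: drsubmx H - (ursubmx H)^T *m ursubmx H.

Lemma schur_block n (H : 'M[int]_(1 + n)) :
  H^T = H -> H = block_mx (H 0 0)%:M (ursubmx H) (ursubmx H)^T (drsubmx H).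
Proof.
move=> Hsym; rewrite trmx_ursub Hsym -[LHS]submxK; congr (block_mx _ _ _ _).
apply/matrixP => i j; rewrite !ord1 !mxE eqxx mulr1n; congr (H _ _); exact/val_inj.
Qed.

(** Completing the square in the first variable. *)
Lemma qform_schur n (H : 'M[int]_(1 + n)) t (y : 'rV_n) :
  H^T = H -> H 0 0 * qform H (row_mx t%:M y) =
    (H 0 0 * t + (y *m (ursubmx H)^T) 0 0) ^+ 2 + qform (schur H) y.
Proof.
move=> Hsym; rewrite /qform /schur; set a := H 0 0; set b := ursubmx H.
rewrite {1}(schur_block Hsym) -/a -/b mul_row_block tr_row_mx mul_row_col.
set be := (y *m b^T) 0 0; set c := drsubmx H.
have Dbe : y *m b^T = be%:M by rewrite [LHS]mx11_scalar.
have Dbe' : b *m y^T = be%:M by rewrite -[LHS]trmxK trmx_mul trmxK Dbe tr_scalar_mx.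
rewrite Dbe tr_scalar_mx -scalar_mxM -raddfD /= -scalar_mxM.
rewrite mulmxDl -(mulmxA t%:M) Dbe' -scalar_mxM.
rewrite mulmxBr mulmxBl -scalemxAr -scalemxAl.
rewrite mulmxA Dbe -(mulmxA be%:M) Dbe' -scalar_mxM !mxE eqxx !mulr1n.
by set Q := \sum_(i < n) _; rewrite -[Q]/Q; ring.
Qed.

Lemma qform_delta n (G : 'M[int]_n) i : qform G (delta_mx 0 i) = G i i.
Proof. by rewrite /qform trmx_delta -rowE -colE !mxE. Qed.

Lemma delta_row_neq0 n (i : 'I_n) : (delta_mx 0 i : 'rV[int]_n) != 0.
Proof. by apply/eqP => /matrixP/(_ 0 i); rewrite !mxE !eqxx. Qed.

(** A block row operation of determinant [a ^+ n.+1] clears the first column, and one factor [a]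
    cancels against the corner. *)
Lemma det_schur n (H : 'M[int]_(1 + n.+1)) :
  H^T = H -> H 0 0 != 0 -> \det (schur H) = H 0 0 ^+ n * \det H.
Proof.
move=> Hsym a_n0; set a := H 0 0 in a_n0 *; set b := ursubmx H.
have : block_mx (1%:M : 'M_1) 0 (- b^T) a%:M *m H = block_mx a%:M b 0 (schur H).
  rewrite {1}(schur_block Hsym) -/a -/b mulmx_block !mul1mx !mul0mx !addr0.
  by rewrite mulNmx mul_mx_scalar mul_scalar_mx addNr mulNmx mul_scalar_mx addrC.
move/(congr1 (fun M => \det M)); rewrite det_mulmx det_lblock det_ublock.
rewrite det1 !det_scalar mul1r expr1 exprS -mulrA.
by move/(mulfI a_n0) => ->.
Qed.

Lemma posdef_diag_gt0 n (H : 'M[int]_(1 + n)) : posdef H -> 0 < H 0 0.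
Proof.
move=> [_ Hpos]; rewrite -qform_delta Hpos ?delta_row_neq0 //.
Qed.

Lemma posdef_schur n (H : 'M[int]_(1 + n)) : posdef H -> posdef (schur H).
Proof.
move=> Hpd; have a_gt0 := posdef_diag_gt0 Hpd; have [Hsym Hpos] := Hpd.
split=> [|y y_n0].
  rewrite /schur linearB linearZ /= trmx_mul trmxK; congr (_ *: _ - _).
  by rewrite -{2}Hsym trmx_drsub.
(* Scaling [y] by the corner entry lets an integral first coordinate make the square vanish. *)
have := qform_schur (- (y *m (ursubmx H)^T) 0 0) (H 0 0 *: y) Hsym.
have -> : ((H 0 0 *: y) *m (ursubmx H)^T) 0 0 = H 0 0 * (y *m (ursubmx H)^T) 0 0.
  by rewrite -scalemxAl mxE.
rewrite mulrN addNr expr0n add0r.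
have -> : qform (schur H) (H 0 0 *: y) = H 0 0 ^+ 2 * qform (schur H) y.
  by rewrite /qform linearZ /= -!scalemxAl -scalemxAr !mxE mulrA.
rewrite -(pmulr_rgt0 _ (exprn_gt0 2 a_gt0)) => <-.
rewrite pmulr_rgt0 // Hpos //; apply: contra y_n0; rewrite row_mx_eq0 => /andP[_].
move=> /eqP/rowP y0; apply/eqP/rowP => j.
by have /eqP := y0 j; rewrite !mxE mulf_eq0 gt_eqF // => /eqP.
Qed.

Lemma centered_remainder (a b : int) : 0 < a -> exists t, 4 * (a * t + b) ^+ 2 <= a ^+ 2.
Proof.
move=> a_gt0; have := ltz_pmod b a_gt0; have := modz_ge0 b (lt0r_neq0 a_gt0).
have := divz_eq b a; set r := (b %% a)%Z; set q := (b %/ a)%Z => Db r_ge0 r_lt.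
have [le_ra|lt_ar] := lerP (2 * r) a.
  exists (- q); have -> : a * - q + b = r by rewrite Db; ring.
  nra.
exists (- q - 1); have -> : a * (- q - 1) + b = r - a by rewrite Db; ring.
nra.
Qed.

(* The vector is the first row of a unimodular matrix obtained from
   [block_mx 1 0 T V] by exchanging the first two rows. *)
Lemma lift_row n (V : 'M[int]_n.+1) t :
  V \in unitmx -> exists2 W : 'M[int]_(1 + n.+1), W \in unitmx &
    row 0 W = row_mx t%:M (row 0 V).
Proof.
move=> Vu; pose B : 'M[int]_(1 + n.+1) := block_mx 1%:M 0 (const_mx t) V.
exists (xrow 0 (rshift 1 0) B).
  rewrite xrowE unitmx_mul unitmx_perm unitmxE det_lblock det1 mul1r.
  by rewrite -unitmxE.
have -> : row 0 (xrow 0 (rshift 1 0) B) = row (rshift 1 0) B.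
  by apply/rowP => j; rewrite [LHS]mxE [LHS]mxE tpermL [RHS]mxE.
rewrite rowKd row_row_mx; congr row_mx.
by apply/rowP => j; rewrite !mxE ord1 mulr1n.
Qed.

(** In the completed square the first coordinate [t] is free; the centered remainder keeps the
    square below a quarter of [H 0 0 ^+ 2]. *)
Lemma reduce_second n (H : 'M[int]_(1 + n.+1)) (V : 'M[int]_n.+1) :
  posdef H -> V \in unitmx ->
  exists W : 'M[int]_(1 + n.+1), exists t : int, [/\ W \in unitmx,
    row 0 W = row_mx t%:M (row 0 V) &
    4 * (H 0 0 * qform H (row 0 W)) <= H 0 0 ^+ 2 + 4 * qform (schur H) (row 0 V)].
Proof.
move=> Hpd Vu.
have [t t_le] := centered_remainder ((row 0 V *m (ursubmx H)^T) 0 0) (posdef_diag_gt0 Hpd).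
have [W Wu DW] := lift_row t Vu; exists W, t; split=> //.
by rewrite DW qform_schur ?mulrDr ?lerD2r //; case: Hpd.
Qed.

(** Hermite's induction. Let [a] be the least value at a first row of a unimodular matrix. Lifting a
    short vector of the Schur complement, of value [h], gives another such row, so
    [3 * a ^+ 2 <= 4 * h]. The induction bound on [h] contains [a ^+ n], which cancels. *)
Lemma hermite n : exists2 C : int, 0 <= C & forall G : 'M[int]_n.+1, posdef G ->
  exists2 U : 'M[int]_n.+1, U \in unitmx & qform G (row 0 U) ^+ n.+1 <= C * \det G.
Proof.
elim: n => [|n [C C_ge0 IHn]].
  exists 1 => // G _; exists 1%:M; rewrite ?unitmx1 //.
  by rewrite expr1 mul1r det_mx11 row1 qform_delta.
exists (4 ^+ n.+1 * C) => [|G Gpd]; first by rewrite mulr_ge0 ?exprn_ge0.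
pose P m := exists2 U : 'M[int]_n.+2, U \in unitmx & absz (qform G (row 0 U)) = m.
have exP : exists m, `[< P m >].
  by exists (absz (qform G (row 0 1%:M))); apply/asboolP; exists 1%:M; rewrite ?unitmx1.
case: (ex_minnP exP) => m /asboolP[U Uu Um] m_min; exists U => //.
pose H : 'M_(1 + n.+1) := U *m G *m U^T.
have Hpd : posdef H by apply: posdef_congr.
have row0 (W : 'M[int]_n.+2) : row 0 (W *m U) = row 0 W *m U by rewrite row_mul.
have H00 : H 0 0 = qform G (row 0 U).
  by rewrite -[U in row 0 U]mul1mx row0 -qform_congr row1 qform_delta.
have a_gt0 := posdef_diag_gt0 Hpd; have [Hsym _] := Hpd.
have H_min (W : 'M[int]_n.+2) : W \in unitmx -> H 0 0 <= qform H (row 0 W).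
  move=> Wu; rewrite H00 qform_congr -row0.
  have le_m : leq (absz (qform G (row 0 U))) (absz (qform G (row 0 (W *m U)))).
    by rewrite Um; apply: m_min; apply/asboolP; exists (W *m U); rewrite ?unitmx_mul ?Wu.
  apply: (le_trans (ler_norm _)); rewrite -lez_nat !abszE in le_m.
  apply: (le_trans le_m); rewrite row0 -qform_congr ger0_norm // ltW //.
  case: Hpd => _; apply.
  by rewrite rowE mulmx_unit_neq0 ?delta_row_neq0.
have [V Vu Vle] := IHn _ (posdef_schur Hpd).
have [W [t [Wu _ Wle]]] := reduce_second Hpd Vu.
have := H_min W Wu; rewrite det_schur ?gt_eqF // in Vle.
rewrite -H00 -(det_congr G Uu) -/H.
move: Vle Wle; set h := qform (schur H) _; set a := H 0 0 in a_gt0 *.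
set x := qform H _ => Vle Wle a_le.
have aa : a ^+ 2 <= a * x by rewrite expr2 ler_pM2l.
have a2_ge0 : 0 <= a ^+ 2 by rewrite exprn_ge0 ?ltW.
have h_ge : 3 * a ^+ 2 <= 4 * h by clear -aa Wle; lra.
have pow_le : (a ^+ 2) ^+ n.+1 <= (4 * h) ^+ n.+1.
  by rewrite lerXn2r ?nnegrE //; clear -a2_ge0 h_ge; lra.
rewrite -(ler_pM2l (exprn_gt0 n a_gt0)) -exprD.
have -> : (n + n.+2 = 2 * n.+1)%N by rewrite mul2n -addnn addnS addSn.
rewrite exprM (le_trans pow_le) // exprMn.
have -> : a ^+ n * (4 ^+ n.+1 * C * \det H) = 4 ^+ n.+1 * (C * (a ^+ n * \det H)) by ring.
by rewrite ler_pM2l ?exprn_gt0.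
Qed.

Lemma hermite2 n : exists B : int -> int, forall (D : int) (G : 'M[int]_n.+2),
  posdef G -> \det G <= D -> exists x y : 'rV[int]_n.+2,
  [/\ qform G x <= B D, qform G y <= B D, x != 0, y != 0 &
      forall c d : int, c *: x = d *: y -> d = 0].
Proof.
have [C C_ge0 hC] := hermite n.+1; have [C' C'_ge0 hC'] := hermite n.
pose A D := C * D.
(* The terms bound the first value [a], its square, and four times the value [h] of the Schur
   complement. *)
exists (fun D => A D + A D ^+ 2 + 4 * (C' * (A D ^+ n * D))) => D G Gpd G_le.
have [U Uu Ule] := hC G Gpd.
pose H : 'M_(1 + n.+1) := U *m G *m U^T.
have Hpd : posdef H by apply: posdef_congr.
have a_gt0 := posdef_diag_gt0 Hpd; have [Hsym _] := Hpd.
have H00 : H 0 0 = qform G (row 0 U).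
  by rewrite -[U in row 0 U]mul1mx row_mul -qform_congr row1 qform_delta.
have [V Vu Vle] := hC' _ (posdef_schur Hpd).
have [W [t [Wu DW Wle]]] := reduce_second Hpd Vu.
rewrite det_schur ?gt_eqF // in Vle.
rewrite -H00 in Ule; rewrite (det_congr _ Uu) in Vle.
move: Ule Vle Wle; set h := qform (schur H) _; set a := H 0 0 in a_gt0 H00 *.
move=> Ule Vle Wle.
have V_n0 : row 0 V != 0.
  by rewrite rowE mulmx_unit_neq0 ?delta_row_neq0.
have h_gt0 : 0 < h by case: (posdef_schur Hpd) => _; apply.
have ge1X (z : int) k : 0 < z -> z <= z ^+ k.+1.
  by move=> z_gt0; rewrite exprS ler_peMr ?(ltW z_gt0) ?exprn_ege1 -?gtz0_ge1.
have a_le : a <= A D.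
  by apply: le_trans (ge1X a _ a_gt0) (le_trans Ule _); rewrite ler_wpM2l.
have D_ge0 : 0 <= \det G.
  have := lt_le_trans (exprn_gt0 n.+2 a_gt0) Ule.
  move=> CG; rewrite leNgt; apply/negP => G_lt0.
  by have := lt_le_trans CG (mulr_ge0_le0 C_ge0 (ltW G_lt0)); rewrite ltxx.
have h_le : h <= C' * (A D ^+ n * D).
  apply: le_trans (ge1X h _ h_gt0) (le_trans Vle _); rewrite ler_wpM2l //.
  by rewrite ler_pM ?exprn_ge0 ?(ltW a_gt0) // lerXn2r ?nnegrE ?(ltW a_gt0) // (le_trans _ a_le) ?ltW.
have a2_le : a ^+ 2 <= A D ^+ 2 by rewrite lerXn2r ?nnegrE ?(ltW a_gt0) // (le_trans _ a_le) ?ltW.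
have W_n0 : row 0 W != 0.
  by rewrite rowE mulmx_unit_neq0 ?delta_row_neq0.
have q_gt0 : 0 < qform H (row 0 W) by case: Hpd => _; apply.
have aq : qform H (row 0 W) <= a * qform H (row 0 W).
  by rewrite ler_peMl ?(ltW q_gt0) -?gtz0_ge1.
have A2_ge0 : 0 <= A D ^+ 2 by rewrite sqr_ge0.
exists (row 0 U), (row 0 W *m U); split.
- by rewrite -H00; clear -a_gt0 a_le A2_ge0 h_gt0 h_le; lra.
- by rewrite -qform_congr -/H; clear -aq Wle a2_le h_le h_gt0 A2_ge0 a_le a_gt0; lra.
- by rewrite rowE mulmx_unit_neq0 ?delta_row_neq0.
- exact: mulmx_unit_neq0.
(* In the basis [U] the first vector has only its first coordinate, while the second has the nonzero
   part [row 0 V]. *)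
move=> c d; rewrite [row 0 U]rowE !scalemxAl => /(congr1 (mulmx^~ (invmx U))).
rewrite /= !mulmxK // DW => /matrixP cd; apply/eqP; apply: contraNT V_n0 => d_n0.
apply/eqP/rowP => j; have := cd 0 (rshift 1 j).
rewrite [LHS]mxE [RHS]mxE row_mxEr mxE mulr0 => /esym/eqP.
by rewrite mulf_eq0 (negPf d_n0) => /eqP ->; rewrite mxE.
Qed.

(** * Finiteness of the fields of bounded discriminant *)

Lemma hermite_basis : exists B : nat -> int -> int,
  forall m (D : int) (G : 'M[int]_m), (1 < m)%N -> posdef G -> \det G <= D ->
  exists x y : 'rV[int]_m, [/\ qform G x <= B m D, qform G y <= B m D,
    x != 0, y != 0 & forall c d : int, c *: x = d *: y -> d = 0].
Proof.
suff /choice[B hB] : forall m, exists B : int -> int, forall (D : int) (G : 'M[int]_m),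
    (1 < m)%N -> posdef G -> \det G <= D ->
    exists x y : 'rV[int]_m, [/\ qform G x <= B D, qform G y <= B D,
      x != 0, y != 0 & forall c d : int, c *: x = d *: y -> d = 0].
  by exists B.
move=> [|[|n]]; [by exists id | by exists id | ].
by have [B hB] := hermite2 n; exists B => D G _; apply: hB.
Qed.

Definition int_comb (K : splittingFieldType rat) n (b : n.-tuple K) (x : 'rV[int]_n) : K :=
  \sum_i tnth b i *~ x 0 i.

Lemma int_comb_eq0 (K : splittingFieldType rat) (b : (\dim {:K}).-tuple K) x :
  basis_of {:K} b -> int_comb b x = 0 -> x = 0.
Proof.
move=> /basis_free/freeP b_free bx; apply/rowP => i; rewrite mxE.
apply/eqP; rewrite -(intr_eq0 rat); apply/eqP.
apply: (b_free (fun j => (x 0 j)%:~R)); rewrite -[RHS]bx.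
by apply: eq_bigr => j _; rewrite scaler_int -tnth_nth.
Qed.

Lemma int_comb_integers (K : splittingFieldType rat) n (b : n.-tuple K) x
    (f : {rmorphism K -> algC}) :
  (forall i, integers (tnth b i)) -> integers (int_comb b x).
Proof.
move=> bZ; apply/(integers_Aint f); rewrite rmorph_sum rpred_sum // => i _.
by rewrite rmorphMz rpredMz //; apply/integers_Aint.
Qed.

Lemma small_generator : exists B : nat -> int -> int,
  forall (K : splittingFieldType rat) (f : {rmorphism K -> algC}),
  galois 1 {:K} -> abelian 'Gal({:K} / 1)%g -> (1 < \dim {:K})%N ->
  exists x : K, [/\ integers x, x \notin 1%VS & forall s : gal_of {:K},
    `|f (s x)| ^+ 2 <= (B (\dim {:K}) `|discriminant K|)%:~R].
Proof.
have [B hB] := hermite_basis; exists B => K f gK Gab dim_gt1.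
have [[b [[b_basis bZ _] Db]] _] := discriminantP gK.
have [s s_bij s_tr] := gal_enum gK.
(* Complex conjugation seen through [f]; as the group is abelian it commutes with every [s k], so
   that [qform G] becomes the sum of the squared absolute values of all conjugates. *)
have [c Dc] := gal_of_aut f Num.conj.
have cs k y : c (s k y) = s k (c y).
  have ck : (s k * c = c * s k)%g by apply: (centsP Gab); apply: gal_all.
  by rewrite -!galM ?memvf // ck.
pose M := conj_mx s b.
have ex (ij : 'I_(\dim {:K}) * 'I_(\dim {:K})) : exists d : int,
    (M *m (map_mx c M)^T) ij.1 ij.2 = d%:~R.
  have [|d Dd] := @integers_trace _ f (tnth b ij.1 * c (tnth b ij.2)) gK.
    apply/(integers_Aint f); rewrite rmorphM rpredM //; first exact/integers_Aint.
    exact/integers_Aint/integers_gal.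
  exists d; rewrite -Dd s_tr mxE; apply: eq_bigr => k _.
  by rewrite !mxE cs rmorphM.
have [G0 DG0] := choice ex.
pose G := \matrix_(i, j) G0 (i, j).
have DG : map_mx intr G = M *m (map_mx c M)^T.
  by apply/matrixP => i j; rewrite !mxE -(DG0 (i, j)) mxE.
have comb_s x k : (map_mx intr x *m M) 0 k = s k (int_comb b x).
  rewrite mxE rmorph_sum; apply: eq_bigr => i _.
  by rewrite !mxE rmorphMz mulrzl.
have qE x : (qform G x)%:~R = \sum_k `|f (s k (int_comb b x))| ^+ 2.
  have -> : (qform G x)%:~R = f ((qform G x)%:~R) by rewrite rmorph_int.
  have -> : (qform G x)%:~R = (map_mx intr x *m M *m (map_mx c (map_mx intr x *m M))^T) 0 0.
    transitivity ((map_mx intr (x *m G *m x^T) : 'M[K]_1) 0 0); first by rewrite mxE.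
    have -> : map_mx c (map_mx intr x *m M) = map_mx intr x *m map_mx c M.
      by rewrite map_mxM; congr (_ *m _); apply/matrixP => i j; rewrite !mxE rmorph_int.
    by rewrite !map_mxM DG -map_trmx trmx_mul !mulmxA.
  rewrite mxE rmorph_sum; apply: eq_bigr => k _; rewrite [_^T _ _]mxE [map_mx c _ _ _]mxE.
  by rewrite comb_s rmorphM /= Dc normCK.
have G_pd : posdef G.
  split=> [|x x_n0].
    have fG i j : (G0 (i, j))%:~R =
        \sum_k f (s k (tnth b i)) * (f (s k (tnth b j)))^*%C.
      rewrite -(rmorph_int f) -(DG0 (i, j)) mxE rmorph_sum.
      by apply: eq_bigr => k _; rewrite !mxE rmorphM /= Dc.
    apply/matrixP => i j; rewrite !mxE; apply: (@intr_inj algC).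
    rewrite -(rmorph_int Num.conj) !fG rmorph_sum; apply: eq_bigr => k _.
    by rewrite rmorphM /= conjCK mulrC.
  rewrite -(ltr0z algC) qE.
  have z_n0 : int_comb b x != 0.
    by apply: contraNneq x_n0 => /(int_comb_eq0 b_basis) ->.
  rewrite (bigD1 (Ordinal (ltnW dim_gt1))) //= ltr_wpDr ?sumr_ge0 ?exprn_gt0 //.
    by move=> k _; rewrite exprn_ge0.
  by rewrite normr_gt0 !fmorph_eq0.
have detG : \det G = `|discriminant K|.
  apply: (@intr_inj algC); rewrite -det_map_mx.
  have -> : map_mx intr G = map_mx f (map_mx intr G).
    by apply/matrixP => i j; rewrite !mxE rmorph_int.
  rewrite DG det_map_mx det_mulmx det_tr det_map_mx rmorphM /= Dc -normCK.
  rewrite -normrX -rmorphXn -(det_trace_mx _ s_tr) Db rmorph_int.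
  by rewrite intr_norm.
have [|x [y [qx qy x_n0 y_n0 xy]]] := hB _ `|discriminant K| G dim_gt1 G_pd.
  by rewrite detG.
have small z : qform G z <= B (\dim {:K}) `|discriminant K| -> forall s' : gal_of {:K},
    `|f (s' (int_comb b z))| ^+ 2 <= (B (\dim {:K}) `|discriminant K|)%:~R.
  move=> qz s'; apply: le_trans (_ : (qform G z)%:~R <= _); last by rewrite ler_int.
  have [t _ ts] := s_bij; rewrite qE (bigD1 (t s')) //= ts lerDl sumr_ge0 // => k _.
  by rewrite exprn_ge0.
have zZ z : integers (int_comb b z) by apply: (int_comb_integers _ f).
have [x_in|x_out] := boolP (int_comb b x \in 1%VS); last first.
  by exists (int_comb b x); split=> //; apply: small.
exists (int_comb b y); split=> //; last exact: small.
apply/negP => y_in.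
have /vlineP[r1 D1] := x_in; have /vlineP[r2 D2] := y_in.
have lin c1 c2 : int_comb b (c1 *: x - c2 *: y) = int_comb b x *~ c1 - int_comb b y *~ c2.
  rewrite /int_comb !mulrz_suml -sumrB; apply: eq_bigr => i _.
  by rewrite !mxE mulrzBr -!mulrzA [c1 * _]mulrC [c2 * _]mulrC.
(* Two rational vectors would satisfy the integral relation obtained by clearing denominators;
   independence then forces [r1] to be zero. *)
have := xy (numq r2 * denq r1) (numq r1 * denq r2).
have -> : numq r2 * denq r1 *: x = numq r1 * denq r2 *: y.
  apply/eqP; rewrite -subr_eq0; apply/eqP/(int_comb_eq0 b_basis); rewrite lin D1 D2.
  apply/eqP; rewrite subr_eq0 -!scaler_int !scalerA !rmorphM /=.
  rewrite -{2}(divq_num_den r1) -{3}(divq_num_den r2); apply/eqP; congr (_ *: _).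
  by field; rewrite !intr_eq0 !denq_eq0.
move=> /(_ erefl)/eqP; rewrite mulf_eq0 denq_eq0 orbF numq_eq0 => /eqP r1_0.
case/negP: x_n0; apply/eqP/(int_comb_eq0 b_basis).
by rewrite D1 r1_0 scale0r.
Qed.

Lemma field_iso_of_image (K L : splittingFieldType rat)
    (f : {rmorphism K -> algC}) (g : {rmorphism L -> algC}) :
  (forall x, exists y, g y = f x) -> (forall y, exists x, f x = g y) ->
  field_iso K L.
Proof.
move=> /choice[h gh] /choice[k fk].
have h_add : zmod_morphism h.
  by move=> x y; apply: (fmorph_inj g); rewrite rmorphB !gh rmorphB.
have h_mul : monoid_morphism h.
  split=> [|x y]; apply: (fmorph_inj g); first by rewrite gh !rmorph1.
  by rewrite rmorphM !gh rmorphM.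
pose haM := GRing.isZmodMorphism.Build _ _ h h_add.
pose hmM := GRing.isMonoidMorphism.Build _ _ h h_mul.
exists (HB.pack h haM hmM : {rmorphism K -> L}).
by exists k => x; [apply: (fmorph_inj f) | apply: (fmorph_inj g)]; rewrite /= ?gh ?fk ?gh.
Qed.

Lemma prime_dim_generator (K : splittingFieldType rat) x y :
  prime (\dim {:K}) -> x \notin 1%VS ->
  exists P : {poly rat}, y = (map_poly (in_alg K) P).[x].
Proof.
move=> dim_pr x_n1.
have Kx : <<1; x>>%VS = {:K}%VS.
  apply/eqP; rewrite eqEdim subvf /=.
  have dvd : (\dim <<1; x>> %| \dim {:K})%N by apply: field_dimS; rewrite subvf.
  have [_ dim1] := primeP dim_pr.
  case/orP: (dim1 _ dvd) => /eqP dimx; last by rewrite dimx.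
  case/negP: x_n1; suff <- : <<1; x>>%VS = 1%VS by apply: memv_adjoin.
  by apply/eqP; rewrite eq_sym eqEdim subv_adjoin dimx dimv1.
have : y \in <<1; x>>%VS by rewrite Kx memvf.
by case/Fadjoin_polyP => R /polyOver1_rat[P ->] ->; exists P.
Qed.

Lemma field_iso_of_conj (K L : splittingFieldType rat)
    (f : {rmorphism K -> algC}) (g : {rmorphism L -> algC}) x y :
  prime (\dim {:K}) -> prime (\dim {:L}) -> x \notin 1%VS -> y \notin 1%VS ->
  f x = g y -> field_iso K L.
Proof.
move=> K_pr L_pr x_n1 y_n1 fg.
have ratf (M : splittingFieldType rat) (h : {rmorphism M -> algC}) P z :
    h (map_poly (in_alg M) P).[z] = (map_poly ratr P).[h z].
  rewrite -horner_map -map_poly_comp; congr (_.[_]).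
  by apply: eq_map_poly => a /=; rewrite rmorphZ_num rmorph1 mulr1.
apply: (field_iso_of_image (f := f) (g := g)) => z.
  have [P ->] := prime_dim_generator z K_pr x_n1.
  by exists (map_poly (in_alg L) P).[y]; rewrite !ratf fg.
have [P ->] := prime_dim_generator z L_pr y_n1.
by exists (map_poly (in_alg K) P).[x]; rewrite !ratf fg.
Qed.

(** The norm of [k%:R - x] is the value at [k] of the characteristic polynomial of [x]. Two monic
    polynomials of degree [n] that agree at [n] points are equal, so they share the root [f x]. *)
Lemma norm_eq_conj (K L : splittingFieldType rat)
    (f : {rmorphism K -> algC}) (g : {rmorphism L -> algC}) x y n :
  galois 1 {:K} -> galois 1 {:L} -> \dim {:K} = n -> \dim {:L} = n ->
  (forall k : 'I_n, f (galNorm 1 {:K} (k%:R - x)) = g (galNorm 1 {:L} (k%:R - y))) ->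
  exists s : gal_of {:L}, f x = g (s y).
Proof.
move=> gK gL dimK dimL fg.
pose P (M : splittingFieldType rat) (h : {rmorphism M -> algC}) (z : M) : {poly algC} :=
  \prod_(s in 'Gal({:M} / 1)%g) ('X - (h (s z))%:P).
have P_mon M h z : P M h z \is monic by apply: monic_prod_XsubC.
have szP (M : splittingFieldType rat) (h : {rmorphism M -> algC}) z :
    galois 1 {:M} -> \dim {:M} = n -> size (P M h z) = n.+1.
  move=> gM <-; rewrite /P -big_enum size_prod_XsubC -cardE.
  by have := galois_dim gM; rewrite dimv1 divn1 => ->.
have P_val (M : splittingFieldType rat) (h : {rmorphism M -> algC}) z (k : nat) :
    (P M h z).[k%:R] = h (galNorm 1 {:M} (k%:R - z)).
  rewrite horner_prod /galNorm rmorph_prod; apply: eq_bigr => s _.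
  by rewrite hornerXsubC !rmorphB !rmorph_nat.
have PP : P K f x = P L g y.
  apply/eqP; rewrite -subr_eq0; apply/eqP.
  apply: (@roots_geq_poly_eq0 _ _ [seq i%:R | i <- iota 0 n]).
  - apply/allP => _ /mapP[k k_n ->]; rewrite mem_iota in k_n.
    rewrite /root hornerD hornerN !P_val subr_eq0; apply/eqP.
    exact: (fg (Ordinal (k_n : (k < n)%N))).
  - rewrite map_inj_uniq ?iota_uniq // => i j /eqP.
    by rewrite eqr_nat => /eqP.
  rewrite size_map size_iota; apply/leq_sizeP => j; rewrite leq_eqVlt coefB.
  have [szK szL] := (szP K f x gK dimK, szP L g y gL dimL).
  case/orP=> [/eqP <-|n_j]; last by rewrite !nth_default ?szK ?szL ?subrr.
  have /monicP := P_mon K f x; have /monicP := P_mon L g y.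
  by rewrite !lead_coefE szK szL /= => -> ->; rewrite subrr.
have : root (P K f x) (f x).
  rewrite /root horner_prod (bigD1 1%g) ?group1 //= gal_id hornerXsubC subrr.
  by rewrite mul0r.
rewrite PP /root horner_prod => /eqP/eqP/prodf_eq0[s _].
by rewrite hornerXsubC subr_eq0 => /eqP; exists s.
Qed.

Lemma inord_absz_inj (N : nat) (a b : int) :
  (`|a| <= N)%N -> (`|b| <= N)%N ->
  inord (absz (a + N%:Z)) = inord (absz (b + N%:Z)) :> 'I_(2 * N).+1 -> a = b.
Proof.
move=> aN bN /(congr1 val) /=; rewrite !inordK; lia.
Qed.

(** Pigeonhole: if discriminants stayed bounded, each field would have a generator with bounded
    conjugates. The [p] norms of [k%:R - x i] are then bounded integers, and two fields with the
    same norms have conjugate generators, hence are isomorphic. *)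
Lemma disc_unbounded (p : nat) (s : signature)
    (L : nat -> splittingFieldType rat) (D : nat) :
  prime p -> (forall i, cyclic_field p s (L i)) ->
  (forall i j, field_iso (L i) (L j) -> i = j) ->
  exists i, (D < `|discriminant (L i)|)%N.
Proof.
move=> p_pr L_cyc L_inj; apply: contrapT => noD.
have L_le i : (`|discriminant (L i)| <= D)%N.
  by rewrite leqNgt; apply/negP => lt_D; apply: noD; exists i.
have gL i : galois 1 {:L i} by case: (L_cyc i).
have dimL i : \dim {:L i} = p by case: (L_cyc i).
have abL i : abelian 'Gal({:L i} / 1)%g by case: (L_cyc i) => _ /cyclic_abelian.
pose f i : {rmorphism L i -> algC} := projT1 (cid (embedding_exists (gL i))).
have [B hB] := small_generator.
have dim_gt1 i : (1 < \dim {:L i})%N by rewrite dimL prime_gt1.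
pose x i := projT1 (cid (hB (L i) (f i) (gL i) (abL i) (dim_gt1 i))).
have xP i : [/\ integers (x i), x i \notin 1%VS & forall t : gal_of {:L i},
    `|f i (t (x i))| ^+ 2 <= (B (\dim {:L i}) `|discriminant (L i)|)%:~R].
  exact: projT2 (cid (hB (L i) (f i) (gL i) (abL i) (dim_gt1 i))).
(* The sum dominates [B p d] for every [d] up to [D], whatever the variation of [B]. *)
pose M : nat := (\sum_(d < D.+1) absz (B p d)%R)%N.
have x_le i (t : gal_of {:L i}) : `|f i (t (x i))| <= M.+1%:R.
  rewrite -(@ler_pXn2r _ 2) ?nnegrE ?ler0n //; have [_ _ /(_ t) xt] := xP i.
  apply: (le_trans xt); rewrite dimL -natrX -[(M.+1 ^ 2)%:R]/((M.+1 ^ 2)%:Z%:~R) ler_int.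
  apply: le_trans (ler_norm _) _; rewrite -abszE lez_nat.
  apply: leq_trans (_ : (M <= _)%N); last first.
    by apply: leq_trans (leqnSn M) _; rewrite -{1}[M.+1]expn1 leq_pexp2l.
  have lt_D : (`|discriminant (L i)| < D.+1)%N by rewrite ltnS.
  by rewrite /M (bigD1 (Ordinal lt_D)) //= leq_addr.
pose N : nat := ((p + M.+1) ^ p)%N.
have ex (ik : nat * 'I_p) : exists v : int, (`|v| <= N)%N /\
    f ik.1 (galNorm 1 {:L ik.1} (ik.2%:R - x ik.1)) = v%:~R.
  case: ik => i k /=; have [xZ _ _] := xP i.
  have /intrP[v Dv] : f i (galNorm 1 {:L i} (k%:R - x i)) \in Num.int.
    apply: Cint_rat_Aint.
      have /vlineP[a ->] := mem_galNorm (gL i) (memvf (k%:R - x i)).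
      by rewrite alg_num_field fmorph_rat; apply/CratP; exists a.
    rewrite rmorph_prod rpred_prod // => t _; rewrite !rmorphB !rmorph_nat.
    by rewrite rpredB ?rpred_nat //; apply/integers_Aint/integers_gal.
  exists v; split=> //; rewrite -(ler_nat algC) natr_absz intr_norm -Dv.
  rewrite rmorph_prod normr_prod.
  apply: le_trans (_ : \prod_(t in 'Gal({:L i} / 1)%g) (p + M.+1)%:R <= _).
    apply: ler_prod => t _; rewrite normr_ge0 /= !rmorphB !rmorph_nat.
    apply: (le_trans (ler_normB _ _)); rewrite natrD lerD ?x_le //.
    by rewrite normr_nat ler_nat ltnW.
  rewrite prodr_const -natrX ler_nat /N.
  by have := galois_dim (gL i); rewrite dimv1 divn1 dimL => <-.
have [v hv] := choice ex.
pose code i : {ffun 'I_p -> 'I_(2 * N).+1} := [ffun k => inord (absz (v (i, k) + N%:Z))].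
pose T := {ffun 'I_p -> 'I_(2 * N).+1}.
(* One more field than there are codes. *)
pose h (i : 'I_#|{: T}|.+1) := code i.
have h_ninj : ~ injective h.
  by move=> h_inj; have := leq_card h h_inj; rewrite card_ord ltnn.
apply: h_ninj => i j hij; apply/val_inj/L_inj.
have vij k : v (val i, k) = v (val j, k).
  have [[vi _] [vj _]] := (hv (val i, k), hv (val j, k)).
  have := congr1 (fun c : T => c k) hij; rewrite !ffunE.
  exact: inord_absz_inj.
have [t ft] : exists t : gal_of {:L j}, f i (x i) = f j (t (x j)).
  apply: (norm_eq_conj (gL i) (gL j) (dimL i) (dimL j)) => k.
  by have [[_ /= ->] [_ /= ->]] := (hv (val i, k), hv (val j, k)); rewrite vij.
have [_ xi_n1 _] := xP i; have [_ xj_n1 _] := xP j.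
apply: (field_iso_of_conj _ _ xi_n1 _ ft); rewrite ?dimL //.
apply: contra xj_n1 => /vlineP[a Da]; apply/vlineP; exists a.
by apply: (fmorph_inj t); apply: etrans Da _; rewrite [RHS]rmorph_alg.
Qed.

(** * Invariance under isomorphism *)

Lemma integers_rmorph (K L : splittingFieldType rat) (phi : {rmorphism K -> L}) x :
  integers (phi x) <-> integers x.
Proof.
have mapE p : map_poly intr p = map_poly phi (map_poly intr p).
  by rewrite -map_poly_comp; apply: eq_map_poly => i /=; rewrite rmorph_int.
by split=> -[p p_mon px]; exists p => //; move: px; rewrite mapE fmorph_root.
Qed.

(** Each [s] extends along the embedding of [K] to an automorphism of [algC], which restricts to
    [L]. *)
Lemma gal_transport (K L : splittingFieldType rat) (phi : {rmorphism K -> L}) :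
  galois 1 {:K} -> galois 1 {:L} -> \dim {:K} = \dim {:L} ->
  exists2 h : gal_of {:K} -> gal_of {:L}, bijective h &
    forall s x, h s (phi x) = phi (s x).
Proof.
move=> gK gL dimKL; have [f _] := embedding_exists gL.
have /choice[h hP] (s : gal_of {:K}) :
    exists t : gal_of {:L}, forall x, t (phi x) = phi (s x).
  have [nu nuP] := extend_algC_subfield_aut (f \o phi) s.
  have [t tP] := gal_of_aut f nu; exists t => x.
  by apply: (fmorph_inj f); rewrite tP; have /= <- := nuP x.
exists h => //; apply: inj_card_bij => [s t hst|].
  by apply/eqP/gal_eqP => x _; apply: (fmorph_inj phi); rewrite -!hP hst.
have card_gal (M : splittingFieldType rat) : galois 1 {:M} -> #|{: gal_of {:M}}| = \dim {:M}.
  move=> gM; have := galois_dim gM; rewrite dimv1 divn1 => ->.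
  by apply: eq_card => x; rewrite !inE gal_all.
by rewrite !card_gal // dimKL.
Qed.

Lemma galTrace_transport (K L : splittingFieldType rat) (phi : {rmorphism K -> L}) x :
  galois 1 {:K} -> galois 1 {:L} -> \dim {:K} = \dim {:L} ->
  galTrace 1 {:L} (phi x) = phi (galTrace 1 {:K} x).
Proof.
move=> gK gL dimKL; have [h h_bij hP] := gal_transport phi gK gL dimKL.
rewrite /galTrace rmorph_sum (reindex h) /=; last exact: onW_bij.
by apply: eq_big => [s|s _]; rewrite ?gal_all ?hP.
Qed.

Lemma is_discriminant_transport (K L : splittingFieldType rat) d :
  galois 1 {:K} -> galois 1 {:L} -> \dim {:K} = \dim {:L} ->
  field_iso K L -> is_discriminant K d -> is_discriminant L d.
Proof.
move=> gK gL e [phi [psi phiK psiK]] [b [[b_basis bZ bgen] Db]].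
(* The cast reconciles two dimensions that are only propositionally equal. *)
pose b' := tcast e [tuple phi (tnth b i) | i < \dim {:K}].
have b'E i : tnth b' i = phi (tnth b (cast_ord (esym e) i)).
  by rewrite tcastE tnth_mktuple.
exists b'; split; first split.
- rewrite basisEfree subvf size_tuple leqnn /= andbT; apply/freeP => c cb i.
  have /freeP b_free := basis_free b_basis.
  rewrite -[i](cast_ordK (esym e)) /=.
  apply: (b_free (fun j => c (cast_ord (esym (esym e)) j))).
  apply: (fmorph_inj phi); rewrite rmorph0 -[RHS]cb rmorph_sum.
  rewrite [RHS](reindex (cast_ord (esym (esym e)))); last first.
    by exists (cast_ord (esym e)) => j _; rewrite ?cast_ordK ?cast_ordKV.
  apply: eq_bigr => j _; rewrite fmorph_numZ -(tnth_nth 0 b) -(tnth_nth 0 b') b'E; congr (_ *: phi (tnth b _)).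
  exact/val_inj.
- by move=> i; rewrite b'E; apply/integers_rmorph.
- move=> y yZ; have /bgen[c Dc] : integers (psi y).
    by apply/(integers_rmorph phi); rewrite psiK.
  exists (fun i => c (cast_ord (esym e) i)).
  rewrite -[LHS]psiK Dc rmorph_sum [RHS](reindex (cast_ord e)) /=; last first.
    by exists (cast_ord (esym e)) => j _; rewrite ?cast_ordK ?cast_ordKV.
  by apply: eq_bigr => i _; rewrite rmorphMz b'E cast_ordK.
have -> : d%:~R = phi (d%:~R) by rewrite rmorph_int.
rewrite -Db -det_map_mx.
pose A := map_mx phi (\matrix_(i, j) galTrace 1 {:K} (tnth b i * tnth b j)).
rewrite -/A.
have -> : \matrix_(i, j) galTrace 1 {:L} (tnth b' i * tnth b' j) =
    \matrix_(i, j) A (cast_ord (esym e) i) (cast_ord (esym e) j).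
  apply/matrixP => i j; rewrite !mxE !b'E -rmorphM.
  exact: galTrace_transport.
move: A {b' b'E}; case: _ / e => A; congr (\det _).
by apply/matrixP => i j; rewrite mxE !cast_ord_id.
Qed.

Lemma rmorphism_inverse (K L : splittingFieldType rat) (phi : {rmorphism K -> L}) :
  bijective phi -> exists2 psi : {rmorphism L -> K}, cancel phi psi & cancel psi phi.
Proof.
move=> [psi phiK psiK].
have psi_add : zmod_morphism psi.
  by move=> x y; apply: (fmorph_inj phi); rewrite rmorphB !psiK.
have psi_mul : monoid_morphism psi.
  split=> [|x y]; apply: (fmorph_inj phi); first by rewrite psiK rmorph1.
  by rewrite rmorphM !psiK.
pose paM := GRing.isZmodMorphism.Build _ _ psi psi_add.
pose pmM := GRing.isMonoidMorphism.Build _ _ psi psi_mul.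
by exists (HB.pack psi paM pmM : {rmorphism L -> K}).
Qed.

Lemma field_iso_sym (K L : splittingFieldType rat) : field_iso K L -> field_iso L K.
Proof.
by move=> [phi /rmorphism_inverse[psi phiK psiK]]; exists psi; exists phi.
Qed.

Lemma discriminant_iso (K L : splittingFieldType rat) :
  galois 1 {:K} -> galois 1 {:L} -> \dim {:K} = \dim {:L} ->
  field_iso K L -> discriminant K = discriminant L.
Proof.
move=> gK gL dimKL KL; rewrite /discriminant; congr (xget _ _).
apply/funext => d; apply/propext; split; apply: is_discriminant_transport => //.
exact: field_iso_sym.
Qed.

Lemma totally_real_iso (K L : splittingFieldType rat) :
  field_iso K L -> totally_real K -> totally_real L.
Proof.
move=> [phi [psi phiK psiK]] Kreal f x.
by rewrite -[x]psiK; apply: (Kreal (f \o phi)).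
Qed.

Lemma totally_positive_iso (K L : splittingFieldType rat) (phi : {rmorphism K -> L}) x :
  bijective phi -> totally_positive x -> totally_positive (phi x).
Proof.
move=> [psi phiK psiK] x_pos f f_real.
by apply: (x_pos (f \o phi)) => y; apply: f_real.
Qed.

Lemma fractional_ideal_preimage (K L : splittingFieldType rat)
    (phi : {rmorphism K -> L}) (I : set L) :
  bijective phi -> fractional_ideal I -> fractional_ideal (phi @^-1` I)%classic.
Proof.
move=> [psi phiK psiK] [Iadd Imul [x Ix x_n0] [d d_n0 dI]]; split => /=.
- by move=> y z Iy Iz; rewrite rmorphD; apply: Iadd.
- by move=> a y aZ Iy; rewrite rmorphM; apply: Imul => //; apply/integers_rmorph.
- by exists (psi x); rewrite /= ?psiK // -(fmorph_eq0 phi) psiK.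
exists (psi d); first by rewrite -(fmorph_eq0 phi) psiK.
move=> y /dI dy; apply/(integers_rmorph phi).
by rewrite rmorphM psiK.
Qed.

(** Taking preimages of ideals under [phi] is injective and carries classes to classes. *)
Lemma ideal_classes_card_le (K L : splittingFieldType rat)
    (phi : {rmorphism K -> L}) (P : set K) (Q : set L) :
  bijective phi -> (forall a, P a <-> Q (phi a)) ->
  (ideal_classes Q #<= ideal_classes P)%card.
Proof.
move=> phi_bij PQ; have [psi phiK psiK] := phi_bij.
pose pre (J : set L) : set K := (phi @^-1` J)%classic.
have pre_inj : injective pre.
  move=> I J /seteqP IJ; apply/seteqP; split=> y; rewrite -[y]psiK.
    exact: (proj1 IJ).
  exact: (proj2 IJ).
pose F (C : set (set L)) : set (set K) := (pre @` C)%classic.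
have F_inj : injective F.
  move=> C D CD; apply/funext => J; apply/propext.
  by rewrite -!(image_inj pre_inj); move: CD; rewrite /F => ->.
have /card_eqPle[_ le1] := inj_card_eq (in2W F_inj : {in ideal_classes Q &, injective F}).
apply: (card_le_trans le1); apply: subset_card_le => _ [C [I I_id ->] <-].
exists (pre I); first exact: fractional_ideal_preimage.
have preM a : pre [set phi a * x | x in I]%classic = [set a * x | x in pre I]%classic.
  apply/seteqP; split=> [y [x Ix xy]|_ [x Ix <-]].
    exists (psi x); first by rewrite /pre /= psiK.
    by apply: (fmorph_inj phi); rewrite rmorphM psiK.
  by exists (phi x); rewrite ?rmorphM.
apply/seteqP; split=> [_ [_ [a [a_n0 Qa ->]] <-]|_ [a [a_n0 Pa ->]]].
  exists (psi a); split; first by rewrite -(fmorph_eq0 phi) psiK.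
    by apply/PQ; rewrite psiK.
  by rewrite -preM psiK.
exists [set phi a * x | x in I]%classic; last exact: preM.
by exists (phi a); rewrite fmorph_eq0; split=> //; apply/PQ.
Qed.

(** For infinite sets both sides are the cardinal of the default value [fset0]. *)
Lemma card_fset_set_eq (T U : choiceType) (A : set T) (B : set U) :
  (A #= B)%card -> #|` fset_set A| = #|` fset_set B|.
Proof.
move=> AB; have [A_fin|A_inf] := pselect (finite_set A).
  have B_fin : finite_set B.
    by apply: card_le_finite A_fin; have /card_eqPle[] := AB.
  apply/card_eq_fsetP; rewrite fset_setK //.
  apply: card_eq_trans AB _; rewrite -{1}(fset_setK B_fin).
  exact/card_eq_fsetP.
have B_inf : ~ finite_set B.
  by move=> B_fin; apply/A_inf/card_le_finite/B_fin; have /card_eqPle[] := AB.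
by rewrite /fset_set; case: pselect => //; case: pselect.
Qed.

Lemma ideal_classes_card_iso (K L : splittingFieldType rat)
    (phi : {rmorphism K -> L}) (P : set K) (Q : set L) :
  bijective phi -> (forall a, P a <-> Q (phi a)) ->
  #|` fset_set (ideal_classes P)| = #|` fset_set (ideal_classes Q)|.
Proof.
move=> phi_bij PQ; apply/card_fset_set_eq/card_eqPle; split; last first.
  exact: (ideal_classes_card_le phi_bij).
have [psi phiK psiK] := rmorphism_inverse phi_bij.
apply: (@ideal_classes_card_le _ _ psi) => [|a]; first by exists phi.
by rewrite -{1}[a]psiK; split=> /PQ.
Qed.

Lemma class_number_iso (K L : splittingFieldType rat) :
  \dim {:K} = \dim {:L} -> field_iso K L -> class_number K = class_number L.
Proof.
move=> dimKL KL; have LK := field_iso_sym KL; rewrite /class_number dimKL.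
have -> : `[< totally_real K >] = `[< totally_real L >].
  by apply: asbool_equiv_eq; split; apply: totally_real_iso.
have [phi phi_bij] := KL; have [psi phiK psiK] := rmorphism_inverse phi_bij.
case: ifP => _; apply: (ideal_classes_card_iso phi_bij) => // a.
split; first exact: totally_positive_iso.
rewrite -{2}[a]phiK; apply: totally_positive_iso; by exists phi.
Qed.

(** * Successive maxima *)

(** A prime [q >= n0] satisfies p <= q^delta and costs nothing; the fewer than or equal to [n0]
    smaller primes cost a factor [p] each, collected in the constant. *)
Lemma omega_bound (R : realType) (p : nat) (delta : R) :
  prime p -> 0 < delta -> exists2 c : R, 0 < c &
    forall D : nat, (0 < D)%N -> p%:R ^+ omega D <= c * D%:R `^ delta.
Proof.
move=> p_pr d_gt0; have p_gt0 : 0 < p%:R :> R by rewrite ltr0n prime_gt0.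
pose n0 := (Num.truncn (p%:R `^ delta^-1 : R)).+1.
exists (p%:R ^+ n0); first exact: exprn_gt0.
move=> D D_gt0; pose c (q : nat) : R := if (q < n0)%N then p%:R else 1.
have c_gt0 q : 0 < c q by rewrite /c; case: ifP.
have big q e : (0 < q)%N -> (0 < e)%N -> p%:R <= c q * (q ^ e)%:R `^ delta :> R.
  move=> q_gt0 e_gt0; have q_le : (q <= q ^ e)%N.
    by rewrite -{1}(expn1 q) leq_pexp2l.
  have qe1 : 1 <= (q ^ e)%:R `^ delta :> R.
    have one : 1 `^ delta = 1 :> R by rewrite powR1.
    by rewrite -{1}one ge0_ler_powR ?nnegrE ?ler01 ?ler0n ?(ltW d_gt0) // ler1n expn_gt0 q_gt0.
  rewrite /c; case: ltnP => [_|n0_q]; first by rewrite ler_peMr ?(ltW p_gt0).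
  rewrite mul1r; have -> : p%:R = (p%:R `^ delta^-1) `^ delta :> R.
    by rewrite -powRrM mulVf ?gt_eqF // powRr1 // ltW.
  rewrite ge0_ler_powR ?nnegrE ?powR_ge0 ?ler0n ?(ltW d_gt0) //.
  apply: (le_trans (ltW (truncnS_gt _))); rewrite ler_nat.
  exact: leq_trans q_le.
have decomp (s : seq (nat * nat)) :
    (forall f, f \in s -> (0 < f.1)%N && (0 < f.2)%N) ->
    p%:R ^+ size s <= (\prod_(f <- s) c f.1) * (\prod_(f <- s) f.1 ^ f.2)%N%:R `^ delta.
  elim: s => [|f s IHs] f_gt0; first by rewrite !big_nil powR1 mulr1.
  have /andP[f1 f2] := f_gt0 f (mem_head _ _).
  rewrite !big_cons exprS natrM powRM ?ler0n // mulrACA.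
  rewrite ler_pM ?exprn_ge0 ?(ltW p_gt0) ?big //.
  by apply: IHs => g gs; apply: f_gt0; rewrite inE gs orbT.
have Dsize : omega D = size (prime_decomp D) by rewrite /omega /primes size_map.
rewrite Dsize; apply: le_trans (decomp _ _) _ => [[q e] /mem_prime_decomp[q_pr e_gt0 _]|].
  by rewrite /= prime_gt0.
rewrite -prod_prime_decomp // ler_wpM2r ?powR_ge0 //.
rewrite -(big_map fst xpredT c) -/(primes D).
rewrite (bigID (fun q => (q < n0)%N)) /= [X in _ * X]big1 ?mulr1; last first.
  by move=> q /negPf q_n0; rewrite /c q_n0.
rewrite (eq_bigr (fun=> p%:R)) => [|q q_n0]; last by rewrite /c q_n0.
rewrite -big_filter big_const_seq count_predT iter_mulr_1.
rewrite ler_weXn2l ?ler1n ?prime_gt0 //.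
rewrite -{2}(size_iota 0 n0); apply: uniq_leq_size; first exact/filter_uniq/primes_uniq.
by move=> q; rewrite mem_filter mem_iota => /andP[].
Qed.

(** Each maximum is itself a term, so some term exceeds it; the least index of such a term gives the
    next maximum. *)
Lemma infinite_maxima (R : realType) (X : nat -> R) :
  (forall i, exists j, X i < X j) -> infinite_successive_maxima X.
Proof.
move=> X_unb [//|n] _; suff [i] : exists i, successive_max X n.+1 (X i) by exists (X i).
elim: n => [|n [i maxi]]; first by exists 0%N; apply: successive_max1.
case: (ex_minnP (X_unb i)) => j ij j_min.
by exists j; apply: (successive_maxS maxi).
Qed.

(** The subtracted 1 allows for the prime [p], which may divide the conductor; every other prime of
    the conductor divides the discriminant. *)
Lemma omega_conductor_le (p : nat) (s : signature) (K : splittingFieldType rat) :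
  prime p -> cyclic_field p s K ->
  (omega (conductor K) - 1 <= omega `|discriminant K|)%N.
Proof.
move=> p_pr [gK _ dimK _]; have [_ disc_n0] := discriminantP gK.
apply: leq_trans (_ : size (rem p (primes (conductor K))) <= _)%N.
  rewrite /omega; have [p_in|p_out] := boolP (p \in primes (conductor K)).
    by rewrite size_rem // subn1.
  by rewrite rem_id // leq_subr.
apply: uniq_leq_size; first exact/rem_uniq/primes_uniq.
move=> q; rewrite mem_rem_uniq ?primes_uniq // inE => /andP[qp q_in].
have q_pr : prime q by move: q_in; rewrite mem_primes => /andP[].
rewrite mem_primes q_pr absz_gt0 disc_n0 /=.
exact: (conductor_dvd_disc gK dimK p_pr q_pr qp q_in).
Qed.

Theorem theorem2p6 (R : realType) (p : nat) (s : signature)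
  (p_prime : prime p)
  (many_large : forall eta : R, 0 < eta < 1 ->
     infinitely_many_fields (fun K => cyclic_field p s K /\
       sqrt_disc R K `^ (1 - eta) <= (class_number K)%:R))
  (eps : R) (eps01 : 0 < eps < 1)
  (K : nat -> splittingFieldType rat)
  (K_enum : enumeration_by_conductor p s K) :
  infinite_successive_maxima (fun i => C_eps p eps (K i)).
Proof.
apply: infinite_maxima => i0; set C := C_eps p eps (K i0).
have /andP[eps_gt0 eps_lt1] := eps01.
(* The margin [t] is shared out: eta is [t / 4] and the exponent for [omega_bound] is [t / 8]. The
   exponent [(1 - t / 4) / 2] of [x] then splits into [t / 8] for the power of [p], [eps / 2] for
   the denominator, and a surplus [t / 4]. *)
pose t := 1 - eps; have t_gt0 : 0 < t by rewrite subr_gt0.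
have t_lt1 : t < 1 by rewrite ltrBlDr ltrDl.
have t8_gt0 : 0 < t / 8 by rewrite divr_gt0.
have [c c_gt0 c_bound] := omega_bound p_prime t8_gt0.
have [|L [L_large L_inj]] := many_large (t / 4).
  by apply/andP; split; lra.
(* The threshold makes x^(t/4) at least [|C| * c + 1], so the surplus beats the constants. *)
have [i D_large] := disc_unbounded (Num.truncn ((`|C| * c + 1) `^ (4 / t))).+1
  p_prime (fun i => proj1 (L_large i)) L_inj.
have [L_cyc L_class] := L_large i.
have [K_cyc _ K_all _] := K_enum; have [j LK] := K_all _ L_cyc.
have [gL _ dimL _] := L_cyc; have [gK _ dimK _] := K_cyc j.
have dimLK : \dim {:L i} = \dim {:K j} by rewrite dimL dimK.
have disc_LK := discriminant_iso gL gK dimLK LK.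
exists j; move: L_class D_large; rewrite (class_number_iso dimLK LK).
rewrite /sqrt_disc disc_LK => K_class D_large.
have disc_gt0 : (0 < `|discriminant (K j)|)%N by apply: leq_trans D_large.
rewrite /C_eps /sqrt_disc.
set x : R := (`|discriminant (K j)|)%N%:R in K_class *.
have x_gt0 : 0 < x by rewrite ltr0n.
have sqrtE a : Num.sqrt x `^ a = x `^ (a / 2).
  by rewrite -powR12_sqrt ?ltW // -powRrM mulrC.
rewrite !sqrtE in K_class *; rewrite ltr_pdivlMr; last first.
  by rewrite mulr_gt0 ?powR_gt0 // exprn_gt0 // ltr0n prime_gt0.
apply: lt_le_trans K_class.
have p_le : p%:R ^+ (omega (conductor (K j)) - 1) <= c * x `^ (t / 8).
  apply: le_trans (c_bound _ disc_gt0); rewrite ler_weXn2l ?ler1n ?prime_gt0 //.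
  exact: omega_conductor_le p_prime (K_cyc j).
apply: le_lt_trans (_ : `|C| * (c * x `^ (t / 8) * x `^ (eps / 2)) < _).
  apply: le_trans (_ : `|C| * (p%:R ^+ (omega (conductor (K j)) - 1) * x `^ (eps / 2)) <= _).
    by rewrite ler_wpM2r ?ler_norm // mulr_ge0 ?powR_ge0 ?exprn_ge0.
  by rewrite ler_wpM2l // ler_wpM2r ?powR_ge0.
have -> : (1 - t / 4) / 2 = t / 8 + eps / 2 + t / 4 by rewrite /t; field.
rewrite !powRD ?(gt_eqF x_gt0) ?implybT //.
set y := x `^ (t / 8) * _.
have -> : `|C| * (c * x `^ (t / 8) * x `^ (eps / 2)) = `|C| * c * y by rewrite /y; ring.
rewrite [X in _ < X]mulrC ltr_pM2r; last by rewrite mulr_gt0 ?powR_gt0.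
have big_x : (`|C| * c + 1) `^ (4 / t) <= x.
  apply: le_trans (ltW (truncnS_gt _)) _; rewrite ler_nat; exact: ltnW.
have C_ge0 : 0 <= `|C| * c by rewrite mulr_ge0 // ltW.
apply: lt_le_trans (_ : `|C| * c + 1 <= _); first by rewrite ltrDl.
have -> : `|C| * c + 1 = ((`|C| * c + 1) `^ (4 / t)) `^ (t / 4).
  rewrite -powRrM (_ : 4 / t * (t / 4) = 1) ?powRr1 ?addr_ge0 //.
  by field; rewrite gt_eqF.
by rewrite ge0_ler_powR ?nnegrE ?powR_ge0 ?(ltW x_gt0) // divr_ge0 ?(ltW t_gt0).
Qed.
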